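(* Let $\Omega$ be a $\sigma$-compact metric space, $\nu$ a probability measure on its Borel $\sigma$-field, $\mathcal{C}\in\mathbb{C}^{I_1\times\cdots\times I_N\times I_1\times\cdots\times I_N}$ a nonnegative Hermitian tensor and $\tau\mapsto\mathcal{D}_\tau$ a continuous map from $\Omega$ into nonnegative Hermitian tensors of the same size with $\sup_\tau\|\mathcal{D}_\tau\|<\infty$, all of Hermitian rank $r$, and assume $\int_\Omega\|\mathcal{D}_\tau^{-p}\|_\rho\,d\nu(\tau)<\infty$ for any $p>0$. Then the following three statements are equivalent: (i) $\vec\lambda(\mathcal{C})\prec_{\log}\exp\int_{\Omega^r}\log\vec\lambda(\mathcal{D}_\tau)\,d\nu^r(\tau)$; (ii) for every continuous $f:(0,\infty)\to[0,\infty)$ such that $x\mapsto\log f(e^x)$ is convex on $\mathbb{R}$ and every unitarily invariant norm, $\|f(\mathcal{C})\|_\rho\le\exp\int_\Omega\log\|f(\mathcal{D}_\tau)\|_\rho\,d\nu(\tau)$; (iii) for every continuous $g:(0,\infty)\to[0,\infty)$ such that $x\mapsto g(e^x)$ is convex on $\mathbb{R}$ and every unitarily invariant norm, $\|g(\mathcal{C})\|_\rho\le\int_\Omega\|g(\mathcal{D}_\tau)\|_\rho\,d\nu(\tau)$.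
   Context: Einstein product and conjugate transpose over multi-indices as usual; Hermitian tensors decompose as $\mathcal{H}=\sum_{i=1}^r\lambda_i\mathcal{U}_i\otimes\mathcal{U}_i^H$ with real Hermitian eigenvalues and orthonormal $\mathcal{U}_i$, $r$ the Hermitian rank, $\vec\lambda(\mathcal{H})$ the decreasing vector of Hermitian eigenvalues; nonnegative means all Hermitian eigenvalues $\ge0$; functions of Hermitian tensors (including negative powers) act on Hermitian eigenvalues; $|\mathcal{A}|=(\mathcal{A}^H\star_N\mathcal{A})^{1/2}$; $\|\cdot\|$ is the operator norm. Conventions $\log0=-\infty$, $e^{-\infty}=0$; vector operations are componentwise, $\int_{\Omega^r}\log\vec\lambda(\mathcal{D}_\tau)d\nu^r(\tau)=\left(\int_\Omega\log\lambda_i(\mathcal{D}_\tau)d\nu(\tau)\right)_{i=1}^r$. For decreasingly ordered $\mathbf{x},\mathbf{y}\in\mathbb{R}^r_{\ge0}$, $\mathbf{x}\prec_{\log}\mathbf{y}$ means $\prod_{i=1}^kx_i\le\prod_{i=1}^ky_i$ for $k=1,\dots,r$ with equality for $k=r$. A unitarily invariant norm satisfies $\|\mathcal{U}\mathcal{H}\|_\rho=\|\mathcal{H}\mathcal{U}\|_\rho=\|\mathcal{H}\|_\rho$ for unitary $\mathcal{U}$ and $\|\mathcal{H}\|_\rho=\rho(\vec\lambda(|\mathcal{H}|))$ for a symmetric gauge function $\rho$. *)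

(* Defs.v *)
From HB Require Import structures.
From mathcomp Require Import all_boot all_order all_algebra.
From mathcomp Require Import all_classical all_reals all_analysis.
From mathcomp.real_closed Require Import complex.
Set Implicit Arguments. Unset Strict Implicit. Unset Printing Implicit Defensive.
Import Order.TTheory GRing.Theory Num.Theory.
Import numFieldNormedType.Exports.
Local Open Scope complex_scope.
Local Open Scope ring_scope.
Local Open Scope classical_set_scope.

Section Tensors.
Variables (R : realType) (N : nat) (I : 'I_N -> nat).
Local Notation C := R[i].

Definition mindex := {dffun forall k : 'I_N, 'I_(I k)}.
Definition vtensor := {ffun mindex -> C}.
Definition tensor := {ffun mindex * mindex -> C}.

Definition einstein (A B : tensor) : tensor :=
  [ffun ij => \sum_(k : mindex) A (ij.1, k) * B (k, ij.2)].
Definition einstein_v (A : tensor) (x : vtensor) : vtensor :=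
  [ffun i => \sum_(k : mindex) A (i, k) * x k].
Definition ctrans (A : tensor) : tensor := [ffun ij => (A (ij.2, ij.1))^*].
Definition hermitian (A : tensor) : Prop := ctrans A = A.
Definition id_tensor : tensor := [ffun ij => (ij.1 == ij.2)%:R].
Definition unitary (U : tensor) : Prop := einstein (ctrans U) U = id_tensor.
Definition vdot (x y : vtensor) : C := \sum_(i : mindex) x i * (y i)^*.
Definition outer (x y : vtensor) : tensor := [ffun ij => x ij.1 * (y ij.2)^*].

Definition herm_decomp (H : tensor) (s : seq R) (U : nat -> vtensor) : Prop :=
  [/\ sorted (fun a b => b <= a) s, all (fun a => a != 0) s,
      (forall i j, (i < size s)%N -> (j < size s)%N ->
          vdot (U i) (U j) = (i == j)%:R)
    & H = \sum_(i < size s) (s`_i)%:C *: outer (U i) (U i)].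

(** decreasing vector of Hermitian eigenvalues (well defined by uniqueness of
    the spectrum; [::] if H admits no such decomposition) *)
Definition heig (H : tensor) : seq R :=
  xget [::] [set s | exists U, herm_decomp H s U].
Definition hrank (H : tensor) : nat := size (heig H).
Definition nonneg_herm (H : tensor) : Prop :=
  hermitian H /\ all (fun a => 0 <= a) (heig H).

Definition tfun (f : R -> R) (H : tensor) : tensor :=
  xget 0 [set G | exists s U, herm_decomp H s U /\
                    G = \sum_(i < size s) (f s`_i)%:C *: outer (U i) (U i)].

Definition vnorm (x : vtensor) : R := Num.sqrt (complex.Re (vdot x x)).
Definition opnorm_le (A : tensor) (M : R) : Prop :=
  forall x, vnorm (einstein_v A x) <= M * vnorm x.

Definition ui_norm (nrm : tensor -> R) : Prop :=
  [/\ forall A, 0 <= nrm A,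
      forall A, nrm A = 0 -> A = 0,
      forall (a : C) A, (nrm (a *: A))%:C = `|a| * (nrm A)%:C,
      forall A B, nrm (A + B) <= nrm A + nrm B
    & forall U A, unitary U ->
        nrm (einstein U A) = nrm A /\ nrm (einstein A U) = nrm A].

End Tensors.

Definition lnE {R : realType} (x : R) : \bar R :=
  if x <= 0 then -oo%E else (ln x)%:E.

(** log-majorization x <_log y of decreasingly ordered nonnegative vectors *)
Definition logmaj {R : realType} (x y : seq (\bar R)) : Prop :=
  size x = size y /\
  (forall k, (k <= size x)%N ->
     (\prod_(i < k) x`_i <= \prod_(i < k) y`_i)%E) /\
  (\prod_(i < size x) x`_i = \prod_(i < size x) y`_i)%E.

Definition sigma_compact (T : topologicalType) : Prop :=
  exists K : nat -> set T, (forall n, compact (K n)) /\ \bigcup_n K n = setT.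

Notation borel T := (g_sigma_algebraType (@open T)).

Definition logexp_convex {R : realType} (f : R -> R) : Prop :=
  forall x y t : R, 0 <= t <= 1 ->
    (lnE (f (expR (t * x + (1 - t) * y)))
      <= t%:E * lnE (f (expR x)) + (1 - t)%:E * lnE (f (expR y)))%E.

Definition exp_convex {R : realType} (g : R -> R) : Prop :=
  forall x y t : R, 0 <= t <= 1 ->
    g (expR (t * x + (1 - t) * y)) <= t * g (expR x) + (1 - t) * g (expR y).

(* Main.v *)
Require Import Defs.
From HB Require Import structures.
From mathcomp Require Import all_boot all_order all_algebra.
From mathcomp Require Import all_classical all_reals all_analysis.
From mathcomp.real_closed Require Import complex.
From mathcomp Require Import perm spectral sesquilinear measurable_realfun ring lra.
Import Order.TTheory GRing.Theory Num.Theory Num.Def.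
Import numFieldNormedType.Exports.
Set Implicit Arguments.
Unset Strict Implicit.
Unset Printing Implicit Defensive.
Local Open Scope ring_scope.
Local Open Scope classical_set_scope.

(** A norm of a function of [H] only depends on the eigenvalues: evaluated on
    [P^* diag(x) P], a unitarily invariant norm is a symmetric gauge of [x].
    By Hahn-Banach the gauge is attained by a linear functional with nonnegative
    weights, which remains below the gauge after permuting the entries.
    Combined with tangent lines of the convex function [g o exp] (resp. of
    [log o f o exp], through a weighted AM-GM inequality), this bounds the
    integrand of (iii) (resp. (ii)) at every [t] from below by an affine function
    of the logarithms of the eigenvalues of [D t], up to an arbitrary
    permutation.  Integrating this bound with the permutation that sorts the
    slopes, and summing by parts against the log-majorization, gives (ii) and
    (iii).  Conversely, (ii) or (iii) for the powers [x ^ p] and the Ky Fan norms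
    gives the partial sums of the log-majorization when [p] tends to 0 from the
    right, and the reverse inequality for the full sum when [p] tends to 0 from
    the left.  The Ky Fan norms also show that the eigenvalues are unique and
    depend continuously on the tensor. *)

(** * Majorization, sorting permutations and summation by parts *)

Section Majorization.
Variable R : realFieldType.

Definition decr r (x : 'I_r -> R) := forall i j : 'I_r, (i <= j)%N -> x j <= x i.

(** Bathtub principle: moving weight onto the top [k] entries can only increase the sum. The entry
    [x m], at index [k] or at the last index if [k] is too large, separates the top from the rest,
    so each term of the difference is at least its coefficient times [x m]. *)
Lemma weighted_sum_le_top r (x c : 'I_r -> R) (k : nat) :
  decr x -> (forall j, 0 <= c j <= 1) ->
  \sum_j c j = \sum_(j < r | (j < k)%N) 1 \/
  (forall j, 0 <= x j) /\ \sum_j c j <= \sum_(j < r | (j < k)%N) 1 ->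
  \sum_j c j * x j <= \sum_(j < r | (j < k)%N) x j.
Proof.
case: r x c => [|r] x c decx c01 sumc; first by rewrite !big_ord0.
pose m : 'I_r.+1 := inord (minn k r).
have mE : m = minn k r :> nat by rewrite inordK // ltnS geq_minr.
rewrite (big_mkcond (fun j : 'I_r.+1 => (j < k)%N)) /= in sumc.
rewrite [leRHS]big_mkcond /= -subr_ge0 -sumrB.
apply: (@le_trans _ _
  (\sum_(j < r.+1) ((if (j < k)%N then 1 else 0) - c j) * x m)).
  rewrite -mulr_suml sumrB.
  case: sumc => [->|[x0 sumc]]; first by rewrite subrr mul0r.
  by rewrite mulr_ge0 // subr_ge0.
apply: ler_sum => j _; have /andP[c0 c1] := c01 j.
case: ltnP => jk.
  have : x m <= x j.
    by apply: decx; rewrite mE leq_min (ltnW jk) -ltnS ltn_ord.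
  by nra.
have : x j <= x m by apply: decx; rewrite mE (leq_trans (geq_minl _ _)).
by nra.
Qed.

(** Summation by parts, as an induction on [m]: each decrease of [psi] multiplies a nonnegative
    partial sum of [d]. *)
Lemma abel_sum_ge (psi d : nat -> R) m :
  (forall i, (i < m)%N -> psi i.+1 <= psi i) ->
  (forall k, (k <= m)%N -> 0 <= \sum_(i < k) d i) ->
  psi m * \sum_(i < m.+1) d i <= \sum_(i < m.+1) psi i * d i.
Proof.
elim: m => [|m IH] decpsi d0; first by rewrite !big_ord1.
have {}IH := IH (fun i h => decpsi i (ltnW h)) (fun k h => d0 k (leqW h)).
have := decpsi m (ltnSn _); have := d0 m.+1 (leqnn _).
rewrite ![\sum_(i < m.+2) _]big_ord_recr /= mulrDr; nra.
Qed.

Lemma sorting_perm r (psi : 'I_r -> R) :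
  exists s : 'S_r, decr (fun i => psi (s i)).
Proof.
pose t := [tuple psi i | i < r].
pose u := sort (fun x y => y <= x) t.
have su : size u == r by rewrite size_sort size_tuple.
have geT : total (fun x y : R => y <= x) by move=> x y; exact: le_total.
have geTr : transitive (fun x y : R => y <= x).
  by move=> y x z yx zy; exact: le_trans zy yx.
have /tuple_permP[s us] : perm_eq (Tuple su) t by rewrite perm_sort.
exists s => i j ij.
have uE (l : 'I_r) : nth 0 u l = psi (s l).
  have -> : u = Tuple su by [].
  by rewrite us -tnth_nth tnth_mktuple tnth_mktuple.
rewrite -!uE; apply: (sorted_leq_nth geTr _ _ (sort_sorted geT t)) => //.
  by rewrite inE (eqP su).
by rewrite inE (eqP su).
Qed.

(** Pair [b] with the decreasing rearrangement of [psi]. Since [a] is decreasing, partial sums of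
    any rearrangement of [a] stay below those of [a], hence below those of [b], and summation by
    parts applies. *)
Lemma majorized_linear_le r (psi a b : 'I_r -> R) :
  decr a ->
  (forall k, (k <= r)%N ->
    \sum_(i < r | (i < k)%N) a i <= \sum_(i < r | (i < k)%N) b i) ->
  \sum_i a i = \sum_i b i ->
  exists s : 'S_r, \sum_i psi i * a i <= \sum_i psi i * b (s i).
Proof.
move=> deca ab sumab; have [s decs] := sorting_perm psi.
exists s^-1%g.
rewrite (reindex_inj (@perm_inj _ s)) /=.
rewrite [leRHS](reindex_inj (@perm_inj _ s)) /=.
under [leRHS]eq_bigr do rewrite permK.
case: r => [|r] in psi a b deca ab sumab s decs *.
  by rewrite !big_ord0.
rewrite -subr_ge0 -sumrB; under eq_bigr do rewrite -mulrBr.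
(* [inord] extends both vectors to natural-number indices, as summation by parts requires. *)
pose p i := psi (s (inord i)); pose d i := b (inord i) - a (s (inord i)).
have -> : \sum_(i < r.+1) psi (s i) * (b i - a (s i)) = \sum_(i < r.+1) p i * d i.
  by apply: eq_bigr => i _; rewrite /p /d inord_val.
apply: (le_trans _ (abel_sum_ge _ _)) => [|i ir|k kr].
- have -> : \sum_(i < r.+1) d i = 0; last by rewrite mulr0.
  rewrite -[RHS](subrr (\sum_i a i)) {1}sumab.
  rewrite [X in _ = _ - X](reindex_inj (@perm_inj _ s)) /= -sumrB.
  by apply: eq_bigr => i _; rewrite /d inord_val.
- by apply: decs; rewrite !inordK // ltnS // ltnW.
rewrite (big_ord_widen r.+1 d (leqW kr)) sumrB subr_ge0.
have -> : \sum_(i < r.+1 | (i < k)%N) b (inord i) = \sum_(i < r.+1 | (i < k)%N) b i.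
  by apply: eq_bigr => i _; rewrite inord_val.
apply: le_trans (ab k (leqW kr)).
(* Weights 0 or 1, selecting the entries of [a] that [s] brings into the first [k] places. *)
pose c j : R := if (s^-1%g j < k)%N then 1 else 0.
have -> : \sum_(i < r.+1 | (i < k)%N) a (s (inord i)) = \sum_j c j * a j.
  rewrite [RHS](reindex_inj (@perm_inj _ s)) /= big_mkcond /=.
  apply: eq_bigr => i _; rewrite /c permK inord_val.
  by case: ifP; rewrite (mul1r, mul0r).
apply: weighted_sum_le_top => //.
  by move=> j; rewrite /c; case: ifP; rewrite ?lexx ?ler01.
left; rewrite (reindex_inj (@perm_inj _ s)) /= [RHS]big_mkcond /=.
by apply: eq_bigr => i _; rewrite /c permK.
Qed.

End Majorization.

(** * Finite-dimensional Hahn-Banach theorem and tangents of convex functions *)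

Section Support.
Variable R : realType.

Definition sublinear (V : lmodType R) (rho : V -> R) :=
  (forall x y, rho (x + y) <= rho x + rho y) /\
  (forall c x, 0 <= c -> rho (c *: x) = c * rho x).

Lemma sublinearN (V : lmodType R) (rho : V -> R) x :
  sublinear rho -> - rho (- x) <= rho x.
Proof.
move=> [rhoD rhoZ]; have := rhoD x (- x); rewrite subrr.
have := rhoZ 0 0 (lexx _); rewrite scale0r mul0r => ->; lra.
Qed.

Lemma sublinear_sum (V : lmodType R) (rho : V -> R) (J : finType) (F : J -> V) :
  sublinear rho -> rho (\sum_j F j) <= \sum_j rho (F j).
Proof.
move=> [rhoD rhoZ]; elim/big_rec2: _ => [|j y x _ h].
  by have := rhoZ 0 0 (lexx _); rewrite scale0r mul0r => ->.
by apply: le_trans (rhoD _ _) _; rewrite lerD2l.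
Qed.

(* [rho' x] is the infimum over [t >= 0] of [rho (x + t e) - t rho e], which is
   linear along [e]; iterating over a basis yields the Hahn-Banach functional. *)
Lemma sublinear_refine (V : lmodType R) (rho : V -> R) e : sublinear rho ->
  exists rho', [/\ sublinear rho', forall x, rho' x <= rho x
                 & rho' (- e) <= - rho e].
Proof.
move=> srho; have [rhoD rhoZ] := srho.
pose S (x : V) : set R := [set rho (x + t *: e) - t * rho e | t in [set t : R | 0 <= t]]%classic.
have Sne (x : V) : (S x !=set0)%classic.
  by exists (rho (x + 0 *: e) - 0 * rho e); exists 0 => /=.
have Slb (x : V) : lbound (S x) (- rho (- x)).
  move=> _ [t /= t0 <-]; rewrite -(rhoZ _ _ t0).
  have := rhoD (x + t *: e) (- x); rewrite addrAC subrr add0r; lra.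
have Sinf x : has_inf (S x) by split=> //; exists (- rho (- x)).
have S_le (x : V) (t : R) : 0 <= t -> inf (S x) <= rho (x + t *: e) - t * rho e.
  by move=> t0; apply: ge_inf; [exists (- rho (- x)) | exists t].
have inf_ge (x : V) (y : R) : lbound (S x) y -> y <= inf (S x).
  by move=> h; apply: lb_le_inf.
have posZ (c : R) (x : V) : 0 < c -> inf (S (c *: x)) <= c * inf (S x).
  move=> c0; rewrite mulrC -ler_pdivrMr //; apply: (inf_ge _ _ _) => _ [t /= t0 <-].
  rewrite ler_pdivrMr //.
  have := S_le (c *: x) (c * t) (mulr_ge0 (ltW c0) t0).
  by rewrite -scalerA -scalerDr (rhoZ _ _ (ltW c0)) => /le_trans; apply; lra.
exists (fun x => inf (S x)); split.
- split=> [x y|c x] /=.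
    rewrite -lerBlDr; apply: (inf_ge _ _ _) => _ [t /= t0 <-].
    rewrite lerBlDr -lerBlDl; apply: (inf_ge _ _ _) => _ [u /= u0 <-].
    rewrite lerBlDl; apply: le_trans (S_le _ (u + t) (addr_ge0 u0 t0)) _.
    have := rhoD (x + t *: e) (y + u *: e).
    rewrite addrACA -scalerDl (addrC t); lra.
  rewrite le_eqVlt => /predU1P[<-|c0].
    rewrite scale0r mul0r; apply/eqP; rewrite eq_le; apply/andP; split.
      by have := S_le 0 0 (lexx _); rewrite scale0r addr0 -(scale0r 0) rhoZ // !mul0r subrr.
    apply: (inf_ge _ _ _) => _ [t /= t0 <-]; rewrite add0r rhoZ // subrr //.
  apply/eqP; rewrite eq_le posZ //=.
  have := posZ c^-1 (c *: x); rewrite invr_gt0 scalerK ?gt_eqF // => /(_ c0).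
  by rewrite ler_pdivlMl.
- by move=> x; have := S_le x 0 (lexx _); rewrite scale0r mul0r addr0 subr0.
- have := S_le (- e) 1 ler01; rewrite scale1r mul1r addNr.
  by rewrite -(scale0r 0) rhoZ // mul0r sub0r.
Qed.

(** Linearity along [e], once reached by [rho1], passes to every sublinear [rho2] below it: [rho2 (-
    e) <= rho1 (- e) <= - rho1 e <= - rho2 e]. So refinements can be chained. *)
Lemma sublinear_refine_seq (V : lmodType R) (rho : V -> R) (es : seq V) :
  sublinear rho ->
  exists rho', [/\ sublinear rho', forall x, rho' x <= rho x
                 & forall e, e \in es -> rho' (- e) <= - rho' e].
Proof.
elim: es => [|e es IH] srho; first by exists rho.
have [rho1 [s1 le1 lin1]] := IH srho.
have [rho2 [s2 le2 lin2]] := sublinear_refine e s1.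
exists rho2; split=> // [x|f]; first exact: le_trans (le2 x) (le1 x).
rewrite inE => /predU1P[->|/lin1 h]; first by have := le2 e; lra.
by have := le2 f; have := le2 (- f); lra.
Qed.

(** Refining along [u] first bounds the value at [- u] by [- rho u], so that any linear functional
    below [rho0] attains [rho u] at [u]. Refining along the standard basis then makes the minorant
    linear. *)
Lemma hahn_banach_rV n (rho : 'rV[R]_n -> R) (u : 'rV[R]_n) : sublinear rho ->
  exists w : 'rV[R]_n, \sum_i w 0 i * u 0 i = rho u /\
    forall v : 'rV[R]_n, \sum_i w 0 i * v 0 i <= rho v.
Proof.
move=> srho; have [rho0 [s0 le0 lin0]] := sublinear_refine u srho.
have [rho1 [s1 le1 lin1]] :=
  sublinear_refine_seq [seq delta_mx 0 i : 'rV[R]_n | i <- enum 'I_n] s0.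
pose w : 'rV[R]_n := \row_i rho1 (delta_mx 0 i).
have ge (v : 'rV[R]_n) : rho1 v <= \sum_i w 0 i * v 0 i.
  rewrite {1}(row_sum_delta v).
  apply: (le_trans (sublinear_sum _ s1)); apply: ler_sum.
  move=> i _; rewrite mxE mulrC.
  have [v0|/ltW v0] := leP 0 (v 0 i); first by rewrite s1.2.
  have := lin1 (delta_mx 0 i); rewrite map_f ?mem_enum // => /(_ isT) h.
  by rewrite -[v 0 i]opprK scaleNr -scalerN s1.2 ?oppr_ge0 //; nra.
have le (v : 'rV[R]_n) : \sum_i w 0 i * v 0 i <= rho1 v.
  have : \sum_i w 0 i * (- v) 0 i = - \sum_i w 0 i * v 0 i.
    by rewrite -sumrN; apply: eq_bigr => i _; rewrite [(- v) 0 i]mxE mulrN.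
  have := ge (- v); have := sublinearN v s1; lra.
exists w; split; last first.
  by move=> v; have := le v; have := le1 v; have := le0 v; lra.
have := le u; have := ge u; have := le0 u; have := le1 u.
have := sublinearN u s1; have := le1 (- u); have := lin0; lra.
Qed.

(** The slope is the left derivative at [a], the supremum of the left difference quotients, all of
    which are bounded by each right quotient. *)
Lemma convex_support (G : R -> R) (a : R) :
  (forall x y t, 0 <= t <= 1 ->
    G (t * x + (1 - t) * y) <= t * G x + (1 - t) * G y) ->
  exists s, forall x, G a + s * (x - a) <= G x.
Proof.
move=> cvx.
have slope x y : x < a -> a < y -> (G a - G x) / (a - x) <= (G y - G a) / (y - a).
  move=> xa ay; rewrite ler_pdivlMr ?subr_gt0 // mulrAC ler_pdivrMr ?subr_gt0 //.
  have yx0 : 0 < y - x by lra.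
  (* This weight writes [a] as a convex combination of [x] and [y]. *)
  have := cvx x y ((y - a) / (y - x)).
  rewrite divr_ge0 ?ler_pdivrMr //=; try lra.
  have -> : (y - a) / (y - x) * x + (1 - (y - a) / (y - x)) * y = a.
    by field; rewrite gt_eqF.
  have -> : 1 - (y - a) / (y - x) = (a - x) / (y - x) by field; rewrite gt_eqF.
  have -> : (y - a) / (y - x) * G x + (a - x) / (y - x) * G y =
    ((y - a) * G x + (a - x) * G y) / (y - x) by field; rewrite gt_eqF.
  rewrite ler_pdivlMr // mul1r => /(_ ltac:(lra)); lra.
pose S := [set (G a - G x) / (a - x) | x in [set x | x < a]]%classic.
have Sub y : a < y -> ubound S ((G y - G a) / (y - a)).
  by move=> ay _ [x /= xa <-]; apply: slope.
have supS : has_sup S.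
  split; first by exists ((G a - G (a - 1)) / (a - (a - 1))); exists (a - 1) => //=; lra.
  by exists ((G (a + 1) - G a) / (a + 1 - a)); apply: Sub; lra.
exists (sup S) => x; have [xa|ax|->] := ltgtP x a; last by lra.
  have : (G a - G x) / (a - x) <= sup S.
    by apply: sup_ubound; [exact: supS.2 | exists x].
  rewrite ler_pdivrMr ?subr_gt0 //; lra.
have : sup S <= (G x - G a) / (x - a).
  by apply: ge_sup; [exact: supS.1 | exact: Sub].
rewrite ler_pdivlMr ?subr_gt0 //; lra.
Qed.

End Support.

(** * Completing orthonormal rows to a unitary matrix *)

Section Unitary.
Local Open Scope complex_scope.
Local Open Scope sesquilinear_scope.
Local Open Scope ring_scope.
Variable C : numClosedFieldType.

Lemma trmxC_mul m n p (A : 'M[C]_(m, n)) (B : 'M[C]_(n, p)) :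
  (A *m B)^t* = B^t* *m A^t*.
Proof. by rewrite trmx_mul map_mxM. Qed.

Lemma trmxC_add m n (A B : 'M[C]_(m, n)) : (A + B)^t* = A^t* + B^t*.
Proof. by apply/matrixP => i j; rewrite !mxE rmorphD. Qed.

Lemma unitarymxV n (U : 'M[C]_n) : U \is unitarymx -> U^t* *m U = 1%:M.
Proof. by move=> /unitarymxP/mulmx1C. Qed.

Lemma perm_mx_unitary n (s : 'S_n) : (perm_mx s : 'M[C]_n) \is unitarymx.
Proof. by apply/unitarymxP; rewrite tr_perm_mx map_perm_mx -perm_mxM mulgV perm_mx1. Qed.

(** The rows of [B] are a Gram-Schmidt basis of the orthogonal complement of the rows of [P]. The
    last identity holds because [P] stacked on [B] is square with orthonormal rows, so its right
    inverse is a left inverse. *)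
Lemma unitarymx_complete r n (P : 'M[C]_(r, n)) : P \is unitarymx ->
  exists B : 'M[C]_(n - r, n),
    [/\ B \is unitarymx, P *m B^t* = 0 & P^t* *m P + B^t* *m B = 1%:M].
Proof.
move=> uP; have rn : (r <= n)%N by rewrite -(mxrank_unitary uP) rank_leq_col.
pose O := orthomx conjC (mx_of_hermitian (hermitian1mx n)) P.
have rkO : \rank O = (n - r)%N by rewrite rank_ortho mxrank_unitary.
pose B0 := schmidt (row_base O).
have uB0 : B0 \is unitarymx by rewrite schmidt_unitarymx // rank_leq_col.
have PB0 : B0 *m P^t* = 0.
  by apply/orthomx1P; rewrite eqmx_schmidt_free ?row_base_free // eq_row_base.
move: B0 uB0 PB0; rewrite rkO => B uB BP.
have PB : P *m B^t* = 0.
  by apply: (can_inj (@trmxCK _ _ _)); rewrite trmxC_mul trmxCK BP !raddf0.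
exists B; split=> //.
have lin : (r + (n - r) = n)%N by rewrite subnKC.
have : col_mx P B *m (col_mx P B)^t* = 1%:M.
  rewrite tr_col_mx map_row_mx mul_col_row (unitarymxP uP) (unitarymxP uB) PB BP.
  by rewrite -scalar_mx_block.
(* The stacked matrix has [r + (n - r)] rows, a number equal to [n] but not convertible to it, hence
   the general form with [m = p]. *)
have inv (m p : nat) (X : 'M[C]_(m, p)) (Y : 'M[C]_(p, m)) :
    m = p -> X *m Y = 1%:M -> Y *m X = 1%:M.
  by move=> mp; case: _ / mp in X Y *; exact: mulmx1C.
move=> /(inv _ _ _ _ lin).
by rewrite tr_col_mx map_row_mx mul_row_col.
Qed.

(** Complete both families; [U] carries the rows of [P] to those of [P'] and one complement to the
    other. *)
Lemma unitarymx_transitive r n (P P' : 'M[C]_(r, n)) :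
  P \is unitarymx -> P' \is unitarymx ->
  exists2 U : 'M[C]_n, U \is unitarymx & P' = P *m U.
Proof.
move=> uP uP'; have [B [uB PB PPBB]] := unitarymx_complete uP.
have [B' [uB' PB' PPBB']] := unitarymx_complete uP'.
have BP : B *m P^t* = 0.
  by apply: (can_inj (@trmxCK _ _ _)); rewrite trmxC_mul trmxCK PB !raddf0.
exists (P^t* *m P' + B^t* *m B'); last first.
  by rewrite mulmxDr !mulmxA (unitarymxP uP) PB mul1mx mul0mx addr0.
rewrite -trmxC_unitary; apply/unitarymxP; rewrite trmxCK.
rewrite trmxC_add !trmxC_mul !trmxCK mulmxDl !mulmxDr -!mulmxA.
rewrite !(mulmxA P) !(mulmxA B) (unitarymxP uP) (unitarymxP uB) PB BP.
by rewrite !mul0mx !mul1mx !mulmx0 addr0 add0r.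
Qed.

End Unitary.

(** * Unitarily invariant norms as symmetric gauges of the spectrum *)

Section Gauge.
Local Open Scope complex_scope.
Local Open Scope sesquilinear_scope.
Local Open Scope ring_scope.
Variable R : realType.
Local Notation C := R[i].
Local Notation normc := (@ComplexField.Normc.normc R).

Lemma conj_real (x : R) : (x%:C : C)^* = x%:C.
Proof. exact: conjc_real. Qed.

Definition uinv n (nrm : 'M[C]_n -> R) : Prop :=
  [/\ forall A, 0 <= nrm A,
      forall A, nrm A = 0 -> A = 0,
      forall a A, nrm (a *: A) = normc a * nrm A,
      forall A B, nrm (A + B) <= nrm A + nrm B
    & forall U A, U \is unitarymx ->
        nrm (U *m A) = nrm A /\ nrm (A *m U) = nrm A].

Definition rdiag r (x : 'I_r -> R) : 'M[C]_r := diag_mx (\row_i (x i)%:C).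

(** When the rows of [P] are orthonormal, this is the Hermitian matrix with eigenvalues [x] on the
    conjugated rows of [P] and zero on their orthogonal complement; [r] may be less than [n]. *)
Definition spec r n (P : 'M[C]_(r, n)) (x : 'I_r -> R) : 'M[C]_n :=
  P^t* *m rdiag x *m P.

Lemma rdiagE r (x : 'I_r -> R) i j : rdiag x i j = (if i == j then (x i)%:C else 0).
Proof. by rewrite !mxE; case: eqVneq => [->|]; rewrite ?mulr1n ?mulr0n. Qed.

Lemma rdiagD r (x y : 'I_r -> R) : rdiag (fun i => x i + y i) = rdiag x + rdiag y.
Proof.
by apply/matrixP => i j; rewrite [RHS]mxE !rdiagE; case: eqP; rewrite ?addr0 ?rmorphD.
Qed.

Lemma rdiagZ r c (x : 'I_r -> R) : rdiag (fun i => c * x i) = c%:C *: rdiag x.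
Proof.
by apply/matrixP => i j; rewrite [RHS]mxE !rdiagE; case: eqP; rewrite ?mulr0 ?rmorphM.
Qed.

Lemma mul_rdiag r n (x : 'I_r -> R) (A : 'M[C]_(r, n)) i j :
  (rdiag x *m A) i j = (x i)%:C * A i j.
Proof. by rewrite mul_diag_mx !mxE. Qed.

Lemma specE r n (P : 'M[C]_(r, n)) (x : 'I_r -> R) i j :
  spec P x i j = \sum_l (x l)%:C * ((P l i)^* * P l j).
Proof.
rewrite /spec -mulmxA mxE; apply: eq_bigr => l _.
by rewrite mul_rdiag !mxE mulrCA.
Qed.

Section NormSpec.
Local Open Scope complex_scope.
Local Open Scope sesquilinear_scope.
Local Open Scope ring_scope.
Variables (n : nat) (nrm : 'M[C]_n -> R).
Hypothesis unrm : uinv nrm.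

(** Two orthonormal families differ by a unitary factor on the right, so changing both of them
    multiplies the matrix by unitaries on its two sides. *)
Lemma uinv_embed r (P P' Q Q' : 'M[C]_(r, n)) (M : 'M[C]_r) :
  P \is unitarymx -> P' \is unitarymx -> Q \is unitarymx -> Q' \is unitarymx ->
  nrm (P^t* *m M *m Q) = nrm (P'^t* *m M *m Q').
Proof.
move=> uP uP' uQ uQ'; have [_ _ _ _ nrmU] := unrm.
have [U uU ->] := unitarymx_transitive uP uP'.
have [V uV ->] := unitarymx_transitive uQ uQ'.
have uU' : U^t* \is unitarymx by rewrite trmxC_unitary.
rewrite trmxC_mul.
rewrite !mulmxA.
have [_ ->] := nrmU _ (U^t* *m P^t* *m M *m Q) uV.
rewrite -!mulmxA.
by have [-> _] := nrmU _ (P^t* *m (M *m Q)) uU'.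
Qed.

Lemma spec_sublinear r (P : 'M[C]_(r, n)) :
  sublinear (fun x : 'rV[R]_r => nrm (spec P (x 0))).
Proof.
have [_ _ nrmZ nrmD _] := unrm.
split=> [x y|c x c0].
  rewrite (_ : spec P _ = spec P (x 0) + spec P (y 0)) ?nrmD //.
  rewrite /spec -mulmxDl -mulmxDr -rdiagD; congr (_ *m rdiag _ *m _).
  by apply/funext => i; rewrite mxE.
rewrite (_ : spec P _ = c%:C *: spec P (x 0)).
  by rewrite nrmZ /= expr0n /= addr0 sqrtr_sqr ger0_norm.
rewrite /spec scalemxAl scalemxAr -rdiagZ; congr (_ *m rdiag _ *m _).
by apply/funext => i; rewrite mxE.
Qed.

(** Permuting the entries of [x] amounts to permuting the rows of [P], which keeps them
    orthonormal. *)
Lemma spec_perm r (P P' : 'M[C]_(r, n)) (x : 'I_r -> R) (s : 'S_r) :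
  P \is unitarymx -> P' \is unitarymx ->
  nrm (spec P (x \o s)) = nrm (spec P' x).
Proof.
move=> uP uP'; have us := perm_mx_unitary C s.
transitivity (nrm (spec (perm_mx s^-1%g *m P) x)); last first.
  have uQ := mul_unitarymx (perm_mx_unitary C s^-1%g) uP.
  exact: (uinv_embed (rdiag x) uQ uP' uQ uP').
congr nrm; apply/matrixP => i j; rewrite !specE.
rewrite [RHS](reindex_inj (@perm_inj _ s)) /=; apply: eq_bigr => l _.
by rewrite -row_permE !mxE permK.
Qed.

(** The signs form a unitary diagonal matrix, absorbed into the left factor alone. *)
Lemma spec_sign r (P : 'M[C]_(r, n)) (x e : 'I_r -> R) :
  P \is unitarymx -> (forall i, e i * e i = 1) ->
  nrm (spec P (fun i => e i * x i)) = nrm (spec P x).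
Proof.
move=> uP e1.
have ue : rdiag e \is unitarymx.
  apply/unitarymxP/matrixP => i j; rewrite mul_rdiag mxE [_^T _ _]mxE rdiagE mxE.
  rewrite eq_sym; case: eqP => [->|_]; last by rewrite rmorph0 mulr0.
  by rewrite conj_real -rmorphM e1.
transitivity (nrm ((rdiag e *m P)^t* *m rdiag x *m P)); last first.
  have uQ := mul_unitarymx ue uP.
  exact: (uinv_embed (rdiag x) uQ uP uP uP).
have exE : rdiag (fun i => e i * x i) = (rdiag e)^t* *m rdiag x; last first.
  by rewrite /spec exE trmxC_mul (mulmxA (P^t* )).
apply/matrixP => i j; rewrite [LHS]rdiagE [RHS]mxE (bigD1 j) //= big1 ?addr0.
  rewrite rdiagE eqxx [_^t* _ _]mxE [_^T _ _]mxE rdiagE eq_sym.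
  by case: eqP => [->|_]; rewrite ?conjC0 ?mul0r // conj_real rmorphM.
by move=> l lj; rewrite rdiagE (negPf lj) mulr0.
Qed.

(** Take the absolute values of the Hahn-Banach weights at [u]. Sign invariance keeps them below the
    gauge, and they still attain it at [u] because [u] is nonnegative; permutation invariance
    supplies [s] and [Q]. *)
Lemma spec_dual r (P : 'M[C]_(r, n)) (u : 'I_r -> R) :
  P \is unitarymx -> (forall i, 0 <= u i) ->
  exists w : 'I_r -> R, [/\ forall i, 0 <= w i, \sum_i w i * u i = nrm (spec P u)
    & forall Q (s : 'S_r) v, Q \is unitarymx ->
        \sum_i w i * v (s i) <= nrm (spec Q v)].
Proof.
move=> uP u0.
have [w [wu wle]] := hahn_banach_rV (\row_i u i) (spec_sublinear P).
have le v : \sum_i `|w 0 i| * v i <= nrm (spec P v).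
  pose e i : R := if 0 <= w 0 i then 1 else -1.
  have e1 i : e i * e i = 1 by rewrite /e; case: ifP; rewrite ?mulr1 ?mulrNN ?mulr1.
  rewrite -(spec_sign v uP e1).
  apply: le_trans (_ : _ <= \sum_i w 0 i * (\row_i (e i * v i)) 0 i) _; last first.
    apply: le_trans (wle _) _; rewrite le_eqVlt; apply/orP; left; apply/eqP.
    by congr (nrm (spec _ _)); apply/funext => i; rewrite mxE.
  rewrite le_eqVlt; apply/orP; left; apply/eqP; apply: eq_bigr => i _.
  rewrite [(\row__ _) _ _]mxE mulrA; congr (_ * _); rewrite /e.
  by case: lerP => [/ger0_norm->|/ltr0_norm->]; rewrite ?mulr1 ?mulrN1.
exists (fun i => `|w 0 i|); split=> [//||Q s v uQ]; last first.
  by rewrite -(spec_perm v s uP uQ); exact: le.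
apply/eqP; rewrite eq_le le /=.
have -> : spec P u = spec P ((\row_i u i) 0).
  by congr spec; apply/funext => i; rewrite mxE.
rewrite -wu; apply: ler_sum => i _.
by rewrite [(\row__ _) _ _]mxE ler_wpM2r // ler_norm.
Qed.

End NormSpec.

End Gauge.

(** * Moduli of complex numbers and of the entries of unitary matrices *)

Section Normc.
Local Open Scope complex_scope.
Local Open Scope sesquilinear_scope.
Local Open Scope ring_scope.
Variable R : realType.
Local Notation C := R[i].
Local Notation normc := (@ComplexField.Normc.normc R).

Lemma normc_ge0 (z : C) : 0 <= normc z.
Proof. by case: z => a b; rewrite sqrtr_ge0. Qed.

Lemma normc_real (x : R) : normc x%:C = `|x|.
Proof. by rewrite /= expr0n /= addr0 sqrtr_sqr. Qed.

Lemma sqr_normcE (z : C) : ((normc z) ^+ 2)%:C = z * z^*.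
Proof. by rewrite rmorphXn -[_ ^+ 2]/(`|z| ^+ 2) sqr_normc. Qed.

Lemma normc_sum (J : finType) (P : pred J) (F : J -> C) :
  normc (\sum_(j | P j) F j) <= \sum_(j | P j) normc (F j).
Proof.
elim/big_rec2: _ => [|j x y _ h]; first by rewrite ComplexField.Normc.normc0.
by apply: le_trans (le_normcD _ _) _; rewrite lerD2l.
Qed.

Lemma unitary_row_norm m n (U : 'M[C]_(m, n)) i :
  U \is unitarymx -> \sum_j normc (U i j) ^+ 2 = 1.
Proof.
move=> /unitarymxP /matrixP /(_ i i); rewrite !mxE eqxx mulr1n => UU.
apply: (can_inj (fun x : R => erefl : complex.Re x%:C = x)).
rewrite rmorph_sum rmorph1 -UU; apply: eq_bigr => j _.
by rewrite !mxE; exact: sqr_normcE.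
Qed.

Lemma unitary_col_norm n (U : 'M[C]_n) j :
  U \is unitarymx -> \sum_i normc (U i j) ^+ 2 = 1.
Proof.
rewrite -trmx_unitary => /(unitary_row_norm j) <-.
by apply: eq_bigr => i _; rewrite mxE.
Qed.

Lemma unitary_entry_le1 m n (U : 'M[C]_(m, n)) i j :
  U \is unitarymx -> normc (U i j) <= 1.
Proof.
move=> /(unitary_row_norm i); rewrite (bigD1 j) //= => h.
rewrite -(@ler_pXn2r _ 2) ?nnegrE ?normc_ge0 // expr1n -h lerDl.
by apply: sumr_ge0 => l _; rewrite sqr_ge0.
Qed.

End Normc.

(** * Ky Fan norms and their values on spectra *)

Section KyFan.
Local Open Scope complex_scope.
Local Open Scope sesquilinear_scope.
Local Open Scope ring_scope.
Variable R : realType.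
Local Notation C := R[i].
Local Notation normc := (@ComplexField.Normc.normc R).
Variable n : nat.
Implicit Types A B U V : 'M[C]_n.

(* The Ky Fan [k]-norm in variational form, for which the triangle inequality
   and unitary invariance are immediate. *)
Definition kfsum k U V A := \sum_(i < n | (i < k)%N) normc ((U *m A *m V) i i).

Definition kfset k A : set R :=
  [set x | exists U V, [/\ U \is unitarymx, V \is unitarymx & x = kfsum k U V A]]%classic.

Definition kyfan k A : R := sup (kfset k A).

(** Entries of unitary matrices have modulus at most 1. This crude bound makes the supremum finite
    and later gives Lipschitz continuity in the entries. *)
Lemma kfsum_bound k U V A : U \is unitarymx -> V \is unitarymx ->
  kfsum k U V A <= n%:R * \sum_i \sum_j normc (A i j).
Proof.
move=> uU uV; set K := \sum_i _.
apply: (@le_trans _ _ (\sum_(i < n) K)); last first.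
  by rewrite sumr_const card_ord mulr_natl.
rewrite /kfsum big_mkcond; apply: ler_sum => i _.
have K0 : 0 <= K by apply: sumr_ge0 => j _; apply: sumr_ge0 => l _; exact: normc_ge0.
case: ifP => // _; rewrite mxE; apply: le_trans (normc_sum _ _) _.
rewrite /K exchange_big /=; apply: ler_sum => j _; rewrite ComplexField.Normc.normcM.
rewrite mxE -[leRHS]mulr1; apply: ler_pM; rewrite ?normc_ge0 ?unitary_entry_le1 //.
apply: le_trans (normc_sum _ _) _; apply: ler_sum => l _.
rewrite ComplexField.Normc.normcM -[leRHS]mul1r.
by apply: ler_pM; rewrite ?normc_ge0 ?unitary_entry_le1.
Qed.

Lemma kfsum_le k U V A : U \is unitarymx -> V \is unitarymx ->
  kfsum k U V A <= kyfan k A.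
Proof.
move=> uU uV; apply: (@ub_le_sup _ (kfset k A)); last by exists U, V.
exists (n%:R * \sum_i \sum_j normc (A i j)) => _ [U' [V' [uU' uV' ->]]].
exact: (kfsum_bound k A uU' uV').
Qed.

Lemma unitarymx1 : (1%:M : 'M[C]_n) \is unitarymx.
Proof. by apply/unitarymxP; rewrite trmx1 map_mx1 mulmx1. Qed.

Lemma kyfan_le k A M :
  (forall U V, U \is unitarymx -> V \is unitarymx -> kfsum k U V A <= M) ->
  kyfan k A <= M.
Proof.
move=> h; apply: (@ge_sup _ (kfset k A)); last by move=> _ [U [V [uU uV ->]]]; exact: h.
by exists (kfsum k 1%:M 1%:M A), 1%:M, 1%:M; split=> //; exact: unitarymx1.
Qed.

Lemma kfsum_ge0 k U V A : 0 <= kfsum k U V A.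
Proof. by apply: sumr_ge0 => i _; exact: normc_ge0. Qed.

Lemma kyfan_ge0 k A : 0 <= kyfan k A.
Proof. exact: le_trans (kfsum_ge0 _ _ _ _) (kfsum_le k A unitarymx1 unitarymx1). Qed.

Lemma kyfanZ_le k a A : kyfan k (a *: A) <= normc a * kyfan k A.
Proof.
apply: kyfan_le => U V uU uV.
apply: le_trans (ler_wpM2l (normc_ge0 a) (kfsum_le k A uU uV)).
rewrite /kfsum mulr_sumr; apply: ler_sum => i _.
by rewrite -scalemxAr -scalemxAl mxE ComplexField.Normc.normcM.
Qed.

Lemma kyfanD k A B : kyfan k (A + B) <= kyfan k A + kyfan k B.
Proof.
apply: kyfan_le => U V uU uV.
apply: le_trans (lerD (kfsum_le k A uU uV) (kfsum_le k B uU uV)).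
rewrite /kfsum -big_split; apply: ler_sum => i _ /=.
by rewrite mulmxDr mulmxDl mxE le_normcD.
Qed.

Lemma kyfan_uinv k : (0 < k)%N -> uinv (kyfan k).
Proof.
move=> k0; split; [exact: kyfan_ge0 | | | exact: kyfanD |].
- move=> A A0; apply/matrixP => i j; rewrite mxE.
  have n0 : (0 < n)%N by case: (n) i => [[]|].
  pose o := Ordinal n0.
  apply: ComplexField.Normc.eq0_normc; apply/eqP; rewrite eq_le normc_ge0 andbT -A0.
  (* The two transpositions bring the entry [A i j] to the first diagonal position, which is counted
     since [0 < k]. *)
  apply: le_trans (kfsum_le k A (perm_mx_unitary _ (tperm i o))
                              (perm_mx_unitary _ (tperm j o))).
  rewrite /kfsum (bigD1 o) //= -row_permE -(tpermV j o) -col_permE !mxE !tpermR lerDl.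
  by apply: sumr_ge0 => l _; exact: normc_ge0.
- move=> a A; apply/eqP; rewrite eq_le kyfanZ_le /=.
  have [->|a0] := eqVneq a 0; first by rewrite ComplexField.Normc.normc0 mul0r kyfan_ge0.
  have na0 : 0 < normc a.
    rewrite lt_neqAle normc_ge0 andbT eq_sym; apply: contraNneq a0.
    by move=> /ComplexField.Normc.eq0_normc ->.
  have := kyfanZ_le k a^-1 (a *: A).
  by rewrite scalerA mulVf // scale1r ComplexField.Normc.normcV ler_pdivlMl.
- move=> U A uU; have uU' : U^t* \is unitarymx by rewrite trmxC_unitary.
  have UU := unitarymxP uU; have UU' := unitarymxV uU.
  split; apply/eqP; rewrite eq_le; apply/andP; split; apply: kyfan_le => V W uV uW.
  + apply: le_trans (kfsum_le k A (mul_unitarymx uV uU) uW).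
    by rewrite /kfsum !mulmxA.
  + apply: le_trans (kfsum_le k (U *m A) (mul_unitarymx uV uU') uW).
    by rewrite /kfsum !mulmxA -(mulmxA V _ U) UU' mulmx1.
  + apply: le_trans (kfsum_le k A uV (mul_unitarymx uU uW)).
    by rewrite /kfsum !mulmxA.
  + apply: le_trans (kfsum_le k (A *m U) uV (mul_unitarymx uU' uW)).
    by rewrite /kfsum !mulmxA -(mulmxA _ U) UU mulmx1.
Qed.

(** The diagonal of [U diag(x) V] gives [x j] the weight [c j]. By AM-GM and the unit norm of rows
    and columns, each weight is at most 1 and their total at most [k], so the bathtub bound
    applies. *)
Lemma kyfan_rdiag_le k (x : 'I_n -> R) : (k <= n)%N -> decr x -> (forall i, 0 <= x i) ->
  kyfan k (rdiag x) <= \sum_(i < n | (i < k)%N) x i.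
Proof.
move=> kn decx x0; apply: kyfan_le => U V uU uV.
pose c j := \sum_(i < n | (i < k)%N) normc (U i j) * normc (V j i).
have half (s t : R) : s * t <= (s ^+ 2 + t ^+ 2) / 2.
  by have := sqr_ge0 (s - t); rewrite sqrrB; lra.
apply: (@le_trans _ _ (\sum_j c j * x j)).
  under [leRHS]eq_bigr do rewrite mulr_suml.
  rewrite exchange_big; apply: ler_sum => i _ /=; rewrite -mulmxA mxE.
  apply: le_trans (normc_sum _ _) _; apply: ler_sum => j _.
  rewrite mul_rdiag !ComplexField.Normc.normcM normc_real ger0_norm //.
  by rewrite mulrCA mulrC.
have c0 j : 0 <= c j by apply: sumr_ge0 => i _; rewrite mulr_ge0 ?normc_ge0.
apply: weighted_sum_le_top => // [j|]; last right; last split=> //.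
  rewrite c0 /=; apply: (@le_trans _ _ (\sum_i (normc (U i j) ^+ 2 + normc (V j i) ^+ 2) / 2)).
    rewrite /c big_mkcond; apply: ler_sum => i _ /=.
    by case: ifP => _; [exact: half | rewrite divr_ge0 // addr_ge0 // sqr_ge0].
  rewrite -mulr_suml big_split /= unitary_col_norm // unitary_row_norm //; lra.
rewrite /c exchange_big; apply: ler_sum => i _ /=.
apply: (@le_trans _ _ (\sum_j (normc (U i j) ^+ 2 + normc (V j i) ^+ 2) / 2)).
  by apply: ler_sum => j _; exact: half.
rewrite -mulr_suml big_split /= unitary_col_norm // unitary_row_norm //; lra.
Qed.

(** By invariance [P] may be replaced by a truncated identity [E], which turns the matrix into a
    diagonal one, [x] padded with zeros. The upper bound is [kyfan_rdiag_le]; identity matrices give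
    the lower one. *)
Lemma kyfan_spec k r (P : 'M[C]_(r, n)) (x : 'I_r -> R) :
  P \is unitarymx -> (0 < k <= n)%N -> decr x -> (forall i, 0 <= x i) ->
  kyfan k (spec P x) = \sum_(i < r | (i < k)%N) x i.
Proof.
move=> uP /andP[k0 kn] decx x0.
have rn : (r <= n)%N by rewrite -(mxrank_unitary uP) rank_leq_col.
pose f (i : nat) := if insub i is Some j then x j else 0.
have fE (j : 'I_r) : f j = x j by rewrite /f valK.
have f0 i : 0 <= f i by rewrite /f; case: insub.
have f_out i : (r <= i)%N -> f i = 0.
  by move=> ri; rewrite /f insubF // ltnNge ri.
have decf : decr (fun i : 'I_n => f i).
  move=> i j ij; have [ri|ir] := leqP r j; first by rewrite f_out.
  by rewrite (fE (Ordinal ir)) (fE (Ordinal (leq_ltn_trans ij ir))) decx.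
pose E : 'M[C]_(r, n) := \matrix_(i < r, j < n) (i == j :> nat)%:R.
have uE : E \is unitarymx.
  apply/unitarymxP/matrixP => i j; rewrite !mxE.
  rewrite (bigD1 (widen_ord rn i)) //= big1 ?addr0.
    by rewrite !mxE /= eqxx mul1r conjC_nat eq_sym.
  by move=> l; rewrite !mxE -val_eqE /= eq_sym => /negPf->; rewrite mul0r.
have -> : kyfan k (spec P x) = kyfan k (rdiag (fun i : 'I_n => f i)).
  rewrite /spec (uinv_embed (kyfan_uinv k0) (rdiag x) uP uE uP uE).
  congr kyfan; apply/matrixP => i j; rewrite rdiagE -[LHS]/(spec E x i j) specE.
  have [ri|ir] := leqP r i.
    rewrite f_out // if_same big1 // => l _; rewrite !mxE.
    by rewrite ltn_eqF ?conjC0 ?mul0r ?mulr0 // (leq_trans _ ri).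
  rewrite (bigD1 (Ordinal ir)) //= big1 ?addr0.
    rewrite !mxE /= eqxx conjC1 mul1r -fE /= val_eqE.
    by case: eqP; rewrite (mulr1, mulr0).
  by move=> l; rewrite !mxE -val_eqE /= => /negPf->; rewrite conjC0 mul0r mulr0.
have -> : \sum_(i < r | (i < k)%N) x i = \sum_(i < n | (i < k)%N) f i.
  rewrite (eq_bigr (fun i : 'I_r => f i)) => [|i _]; last by rewrite fE.
  rewrite (big_ord_widen_cond n (fun i => i < k)%N f rn) big_mkcondr /=.
  by apply: eq_bigr => i _; case: ltnP => // /f_out.
apply/eqP; rewrite eq_le kyfan_rdiag_le //=.
apply: le_trans (kfsum_le k _ unitarymx1 unitarymx1).
apply: ler_sum => i _; rewrite mul1mx mulmx1 rdiagE eqxx normc_real.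
exact: ler_norm.
Qed.

Lemma kyfan_lipschitz k A B :
  (0 < k)%N -> `|kyfan k A - kyfan k B| <= n%:R * \sum_i \sum_j normc (A i j - B i j).
Proof.
move=> k0; have [_ _ kZ _ _] := kyfan_uinv k0.
have h X Y : kyfan k X - kyfan k Y <= kyfan k (X - Y).
  by rewrite lerBlDr; apply: le_trans (kyfanD _ _ _); rewrite subrK.
have hN : kyfan k (B - A) = kyfan k (A - B).
  by rewrite -(opprB A B) -scaleN1r kZ normcN ComplexField.Normc.normc1 mul1r.
apply: (@le_trans _ _ (kyfan k (A - B))).
  by rewrite ler_norml (h A B) andbT lerNl opprB -hN (h B A).
apply: kyfan_le => U V uU uV.
have -> : \sum_i \sum_j normc (A i j - B i j) = \sum_i \sum_j normc ((A - B) i j).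
  apply: eq_bigr => i _; apply: eq_bigr => j _; congr normc.
  by rewrite [RHS]mxE [(- B) i j]mxE.
exact: (kfsum_bound k (A - B) uU uV).
Qed.

End KyFan.

(** * Tensors as square matrices, and Hermitian eigenvalues *)

Section Bridge.
Local Open Scope complex_scope.
Local Open Scope sesquilinear_scope.
Local Open Scope ring_scope.
Variables (R : realType) (N : nat) (I : 'I_N -> nat).
Local Notation C := R[i].
Local Notation normc := (@ComplexField.Normc.normc R).
Local Notation n := #|{: mindex I}|.
Implicit Types (A B H : tensor R I) (s : seq R).

Definition mx_of A : 'M[C]_n := \matrix_(i, j) A (enum_val i, enum_val j).
Definition tensor_of (M : 'M[C]_n) : tensor R I :=
  [ffun ij => M (enum_rank ij.1) (enum_rank ij.2)].

Lemma mx_ofK : cancel mx_of tensor_of.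
Proof. by move=> A; apply/ffunP => -[i j]; rewrite ffunE mxE !enum_rankK. Qed.

Lemma tensor_ofK : cancel tensor_of mx_of.
Proof. by move=> M; apply/matrixP => i j; rewrite mxE ffunE /= !enum_valK. Qed.

Lemma mx_of_einstein A B : mx_of (einstein A B) = mx_of A *m mx_of B.
Proof.
apply/matrixP => i j; rewrite !mxE ffunE.
rewrite (reindex_onto enum_val enum_rank) => [|k _]; last by rewrite enum_rankK.
rewrite (eq_bigl xpredT) => [|k]; last by rewrite enum_valK eqxx.
by apply: eq_bigr => k _; rewrite !mxE.
Qed.

Lemma mx_of_ctrans A : mx_of (ctrans A) = (mx_of A)^t*.
Proof. by apply/matrixP => i j; rewrite !mxE ffunE. Qed.

Lemma mx_of_id : mx_of (id_tensor R I) = 1%:M.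
Proof. by apply/matrixP => i j; rewrite !mxE ffunE /= (inj_eq enum_val_inj). Qed.

Lemma mx_ofD A B : mx_of (A + B) = mx_of A + mx_of B.
Proof. by apply/matrixP => i j; rewrite !mxE ffunE. Qed.

Lemma mx_ofZ (a : C) A : mx_of (a *: A) = a *: mx_of A.
Proof. by apply/matrixP => i j; rewrite !mxE ffunE. Qed.

Lemma mx_of_unitary A : unitary A -> mx_of A \is unitarymx.
Proof.
move=> /(congr1 mx_of); rewrite mx_of_einstein mx_of_ctrans mx_of_id => UU.
by apply/unitarymxP; exact: mulmx1C.
Qed.

Lemma tensor_of_unitary (U : 'M[C]_n) : U \is unitarymx -> unitary (tensor_of U).
Proof.
move=> uU; apply: (can_inj mx_ofK).
by rewrite mx_of_einstein mx_of_ctrans tensor_ofK mx_of_id unitarymxV.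
Qed.

Lemma ui_norm_uinv (nrm : tensor R I -> R) :
  ui_norm nrm -> uinv (fun M => nrm (tensor_of M)).
Proof.
case=> [nrm0 nrm_eq0 nrmZ nrmD nrmU]; split=> //.
- by move=> M /nrm_eq0 M0; rewrite -[M]tensor_ofK M0; apply/matrixP => i j; rewrite !mxE ffunE.
- move=> a M; have -> : tensor_of (a *: M) = a *: tensor_of M.
    by apply: (can_inj mx_ofK); rewrite mx_ofZ !tensor_ofK.
  apply: (can_inj (fun x : R => erefl : complex.Re x%:C = x)).
  by rewrite nrmZ rmorphM.
- move=> A B; have -> : tensor_of (A + B) = tensor_of A + tensor_of B; last exact: nrmD.
  by apply: (can_inj mx_ofK); rewrite mx_ofD !tensor_ofK.
move=> U A /tensor_of_unitary uU.
have [] := nrmU _ (tensor_of A) uU.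
have E (X Y : 'M[C]_n) : einstein (tensor_of X) (tensor_of Y) = tensor_of (X *m Y).
  by apply: (can_inj mx_ofK); rewrite mx_of_einstein !tensor_ofK.
by rewrite !E.
Qed.

Lemma uinv_ui_norm (nrm : 'M[C]_n -> R) : uinv nrm -> ui_norm (fun A => nrm (mx_of A)).
Proof.
case=> [nrm0 nrm_eq0 nrmZ nrmD nrmU]; split=> //.
- move=> A /nrm_eq0 A0; rewrite -[A]mx_ofK A0.
  by apply/ffunP => ij; rewrite !ffunE mxE.
- by move=> a A; rewrite mx_ofZ nrmZ rmorphM.
- by move=> A B; rewrite mx_ofD.
by move=> U A /mx_of_unitary uU; rewrite !mx_of_einstein; exact: nrmU.
Qed.

(** The rows of [P] are the conjugated eigenvectors. One [P] serves all [f], so that [H] and its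
    functions are diagonalized together. *)
Lemma herm_decomp_spec H s U : herm_decomp H s U ->
  exists2 P : 'M[C]_(size s, n), P \is unitarymx & forall f : R -> R,
    mx_of (\sum_(i < size s) (f s`_i)%:C *: outer (U i) (U i)) =
    spec P (fun i => f s`_i).
Proof.
case=> _ _ orthU _.
exists (\matrix_(i < size s, j < n) ((U i (enum_val j))^*)).
  apply/unitarymxP/matrixP => i j; rewrite !mxE eq_sym.
  rewrite -val_eqE /= -(orthU j i) // /vdot.
  rewrite [RHS](reindex_onto enum_val enum_rank) => [|k _]; last by rewrite enum_rankK.
  rewrite [RHS](eq_bigl xpredT) => [|k]; last by rewrite enum_valK eqxx.
  by apply: eq_bigr => k _; rewrite !mxE conjCK mulrC.
move=> f; apply/matrixP => i j; rewrite specE mxE sum_ffunE.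
by apply: eq_bigr => l _; rewrite !ffunE !mxE conjCK.
Qed.

Lemma herm_decompE H s U : herm_decomp H s U ->
  H = \sum_(i < size s) (s`_i)%:C *: outer (U i) (U i).
Proof. by case. Qed.

Lemma unitary_rows_leq r (P : 'M[C]_(r, n)) : P \is unitarymx -> (r <= n)%N.
Proof. by move=> uP; rewrite -(mxrank_unitary uP) rank_leq_col. Qed.

Lemma decr_nth s : sorted (fun a b => b <= a) s -> decr (fun i : 'I_(size s) => s`_i).
Proof.
move=> ss i j ij; have geTr : transitive (fun x y : R => y <= x).
  by move=> y x z yx zy; exact: le_trans zy yx.
by apply: (sorted_leq_nth geTr _ _ ss) => //; rewrite inE.
Qed.

(** Each [x' i] is the value of the quadratic form of [spec P x] at a unit vector, that is, a sum of
    the [x j] with weights [normc (Q i j) ^+ 2]. *)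
Lemma spec_ge0 r r' (P : 'M[C]_(r, n)) (P' : 'M[C]_(r', n)) x x' :
  P' \is unitarymx -> spec P x = spec P' x' -> (forall i, 0 <= x i) -> forall i, 0 <= x' i.
Proof.
move=> uP' PP' x0 i.
have : (P' *m spec P x *m P'^t*) i i = (x' i)%:C.
  rewrite PP' /spec !mulmxA (unitarymxP uP') mul1mx -mulmxA (unitarymxP uP') mulmx1.
  by rewrite rdiagE eqxx.
set Q := P' *m P^t*.
have -> : P' *m spec P x *m P'^t* = Q *m (rdiag x *m Q^t*).
  by rewrite /spec /Q trmxC_mul trmxCK !mulmxA.
rewrite mxE => /(congr1 (@complex.Re R)) /= <-.
have -> : \sum_j Q i j * (rdiag x *m Q^t*) j i = (\sum_j x j * normc (Q i j) ^+ 2)%:C.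
  rewrite rmorph_sum; apply: eq_bigr => j _.
  rewrite mul_rdiag rmorphM [_^t* _ _]mxE [_^T _ _]mxE mulrCA; congr (_ * _).
  exact/esym/sqr_normcE.
by apply: sumr_ge0 => j _; rewrite mulr_ge0 ?sqr_ge0.
Qed.

Lemma psum_nth s k : \sum_(i < size s | (i < k)%N) s`_i = \sum_(i < k) s`_i.
Proof.
have [ks|sk] := leqP k (size s); first by rewrite (big_ord_widen (size s) (nth 0 s)).
rewrite (eq_bigl xpredT) => [|i]; last by rewrite (ltn_trans _ sk).
rewrite (big_ord_widen k (nth 0 s) (ltnW sk)) big_mkcond /=.
by apply: eq_bigr => i _; case: ltnP => // si; rewrite nth_default.
Qed.

(** Ky Fan norms depend on [H] alone and equal the partial sums of the eigenvalues in any
    decomposition, so consecutive differences recover the eigenvalues. *)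
Lemma herm_decomp_uniq H s s' U U' : all (fun a => 0 <= a) s ->
  herm_decomp H s U -> herm_decomp H s' U' -> s' = s.
Proof.
move=> s0 d d'.
have [P uP PE] := herm_decomp_spec d; have [P' uP' PE'] := herm_decomp_spec d'.
have HP := PE id; have HP' := PE' id.
rewrite -(herm_decompE d) in HP; rewrite -(herm_decompE d') HP in HP'.
have x0 (i : 'I_(size s)) : 0 <= s`_i by apply: (allP s0); rewrite mem_nth.
have x'0 := spec_ge0 uP' HP' x0.
have [ss sn0 _ _] := d; have [ss' sn0' _ _] := d'.
have psums k : (0 < k <= n)%N -> \sum_(i < k) s`_i = \sum_(i < k) s'`_i.
  move=> kn; rewrite -!psum_nth.
  rewrite -(kyfan_spec uP kn (decr_nth ss) x0).
  by rewrite -(kyfan_spec uP' kn (decr_nth ss') x'0) HP'.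
have nths k : s`_k = s'`_k.
  have [nk|kn] := leqP n k.
    rewrite !nth_default //; first exact: leq_trans (unitary_rows_leq uP') nk.
    exact: leq_trans (unitary_rows_leq uP) nk.
  have := psums k.+1 kn; rewrite !big_ord_recr /=.
  have -> : \sum_(i < k) s`_i = \sum_(i < k) s'`_i; last by move/addrI => ->.
  by case: k kn => [|k] kn; rewrite ?big_ord0 // psums //= ltnW.
(* The default value of [nth] is 0 while listed eigenvalues are nonzero, so equal entries force
   equal lengths. *)
have sz t t' : all (fun a : R => a != 0) t' -> (forall k, t`_k = t'`_k) -> (size t' <= size t)%N.
  move=> t'0 tt'; rewrite leqNgt; apply/negP => lt.
  have /allP/(_ t'`_(size t)) := t'0.
  by rewrite mem_nth // -tt' nth_default // eqxx => /(_ isT).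
have szE : size s' = size s by apply/eqP; rewrite eqn_leq !sz.
by apply: (@eq_from_nth R 0) => // k _; rewrite nths.
Qed.

Lemma heigP H : (exists U, herm_decomp H (heig H) U) \/
  heig H = [::] /\ forall s U, ~ herm_decomp H s U.
Proof.
rewrite /heig; case: xgetP => [s _ h|h]; first by left.
by right; split=> // s U d; apply: (h s); exists U.
Qed.

(** Positive rank guarantees a decomposition, since the default value of [heig] is the empty
    list. *)
Lemma heig_spec H : (0 < hrank H)%N ->
  exists2 P : 'M[C]_(hrank H, n), P \is unitarymx & mx_of H = spec P (fun i => (heig H)`_i).
Proof.
rewrite /hrank; case: (heigP H) => [[U d] _|[-> //]].
have [P uP PE] := herm_decomp_spec d; exists P => //.
by rewrite {1}(herm_decompE d) (PE id).
Qed.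

Lemma heig_decr H : decr (fun i : 'I_(hrank H) => (heig H)`_i).
Proof.
case: (heigP H) => [[U [ss _ _ _]]|[h _]]; first exact: decr_nth.
by rewrite /hrank h => -[].
Qed.

Lemma heig_gt0 H (i : nat) : nonneg_herm H -> (i < hrank H)%N -> 0 < (heig H)`_i.
Proof.
move=> [_ h0] ir; case: (heigP H) => [[U [_ n0 _ _]]|[h _]]; last by rewrite /hrank h in ir.
rewrite lt_neqAle eq_sym; apply/andP; split.
  by apply: (allP n0); rewrite mem_nth.
by apply: (allP h0); rewrite mem_nth.
Qed.

(** The decomposition chosen in [tfun] may have other eigenvectors than the one behind [heig], but
    by uniqueness it has the same eigenvalues. *)
Lemma tfun_spec (f : R -> R) H : nonneg_herm H ->
  exists2 P : 'M[C]_(hrank H, n),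
    P \is unitarymx & mx_of (tfun f H) = spec P (fun i => f (heig H)`_i).
Proof.
move=> [_ h0]; rewrite /tfun; case: xgetP => [G _ [s [U [d ->]]]|hG].
  case: (heigP H) => [[V dV]|[_ /(_ _ _ d) []]].
  have E := herm_decomp_uniq h0 dV d; subst s.
  by have [P uP PE] := herm_decomp_spec d; exists P.
case: (heigP H) => [[V dV]|[h _]].
  by exfalso; apply: (hG _); exists (heig H), V; split; [exact: dV | reflexivity].
(* Without a decomposition [tfun] is 0 and [P] has no rows. *)
rewrite /hrank h; exists 0; first by apply/unitarymxP; rewrite [LHS]flatmx0 [RHS]flatmx0.
by apply/matrixP => i j; rewrite specE big_ord0 !mxE ffunE.
Qed.

(** Apply the operator bound to the unit eigenvector [U i]. *)
Lemma heig_le_opnorm H M (i : nat) :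
  nonneg_herm H -> opnorm_le H M -> (i < hrank H)%N -> (heig H)`_i <= M.
Proof.
move=> nH HM ir; have l0 := heig_gt0 nH ir.
case: (heigP H) => [[U d]|[h _]]; last by rewrite /hrank h in ir.
have [_ _ orthU HE] := d; set l := (heig H)`_i in l0 *.
have EU : einstein_v H (U i) = [ffun a => l%:C * U i a].
  apply/ffunP => a; rewrite !ffunE {1}HE.
  transitivity (\sum_(j < size (heig H)) ((heig H)`_j)%:C * U j a * vdot (U i) (U j)).
    under eq_bigr do rewrite sum_ffunE mulr_suml.
    rewrite exchange_big; apply: eq_bigr => j _ /=.
    rewrite /vdot mulr_sumr; apply: eq_bigr => k _; rewrite !ffunE /=.
    by rewrite -!mulrA [_^* * _]mulrC.
  rewrite (bigD1 (Ordinal ir)) //= big1 ?addr0; first by rewrite orthU // eqxx mulr1.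
  by move=> j; rewrite -val_eqE /= eq_sym => /negPf ji; rewrite orthU // ji mulr0.
have := HM (U i); rewrite EU.
have -> : vnorm (U i) = 1 by rewrite /vnorm orthU // eqxx sqrtr1.
rewrite /vnorm; have -> : vdot [ffun a => l%:C * U i a] [ffun a => l%:C * U i a] = (l ^+ 2)%:C.
  transitivity (l%:C * l%:C * vdot (U i) (U i)).
    rewrite /vdot mulr_sumr; apply: eq_bigr => k _.
    by rewrite !ffunE rmorphM /= conj_real mulrACA.
  by rewrite orthU // eqxx mulr1 rmorphXn.
by rewrite /= sqrtr_sqr ger0_norm ?mulr1 // ltW.
Qed.

End Bridge.

(** * Second-order estimates for the exponential *)

Section Exp.
Variable R : realType.

Lemma expR_second_order (y : R) : expR y - 1 - y <= y ^+ 2 * expR `|y|.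
Proof.
have h1 := expR_ge1Dx y; have h2 := expR_ge1Dx (- y); have e0 := expR_gt0 y.
have h : expR y * (1 - y) <= 1.
  by have := expRxMexpNx_1 y; nra.
have [y0|y0] := leP 0 y.
  by rewrite ger0_norm // expr2; nra.
have e1 : 1 <= expR `|y| by rewrite -expR0 ler_expR normr_ge0.
have : y ^+ 2 <= y ^+ 2 * expR `|y| by rewrite ler_peMr // sqr_ge0.
by rewrite expr2; nra.
Qed.

Lemma sqr_le_expR (x : R) : x ^+ 2 <= 4 * expR `|x|.
Proof.
have h := expR_ge1Dx (`|x| / 2); have x0 := normr_ge0 x.
have -> : expR `|x| = expR (`|x| / 2) * expR (`|x| / 2).
  by rewrite -expRD; congr expR; lra.
by rewrite -real_normK ?num_real // expr2; nra.
Qed.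

Lemma expR_norm_le (x : R) : expR (2 * `|x|) <= expR (2 * x) + expR (- 2 * x).
Proof.
have := expR_gt0 (2 * x); have := expR_gt0 (- 2 * x).
by case: (ger0P x) => _; rewrite ?mulrN ?mulNr; lra.
Qed.

(** The remainder is [p ^+ 2] times a quantity independent of [p]. When [b] is the logarithm of an
    eigenvalue, it involves only the powers 2 and -2 of that eigenvalue. *)
Lemma expR_taylor (p b : R) : `|p| <= 1 ->
  expR (p * b) <= 1 + p * b + p ^+ 2 * (4 * (expR (2 * b) + expR (- 2 * b))).
Proof.
move=> p1; have h := expR_second_order (p * b).
have hb := sqr_le_expR b; have hn := expR_norm_le b.
have e1 : expR `|p * b| <= expR `|b|.
  by rewrite ler_expR normrM ler_piMl.
have e2 : expR (2 * `|b|) = expR `|b| * expR `|b|.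
  by rewrite -expRD; congr expR; lra.
have e0 := expR_gt0 `|b|.
suff : (p * b) ^+ 2 * expR `|p * b| <= p ^+ 2 * (4 * (expR (2 * b) + expR (- 2 * b))).
  lra.
rewrite exprMn -mulrA ler_wpM2l ?sqr_ge0 //.
apply: (@le_trans _ _ (4 * expR `|b| * expR `|b|)); last by nra.
by apply: ler_pM => //; rewrite ?sqr_ge0 ?expR_ge0.
Qed.

End Exp.

(** * Monotonicity of the integral and integrals of affine combinations *)

Section Integration.
Context d (T : measurableType d) (R : realType) (mu : probability T R).
Import HBNNSimple.

(** The integral is a difference of suprema over simple functions lying below the positive and the
    negative part; each supremum is monotone in its integrand. *)
Lemma le_integral_pointwise (f g : T -> \bar R) :
  (forall x, f x <= g x)%E -> (\int[mu]_x f x <= \int[mu]_x g x)%E.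
Proof.
have mono (u v : T -> \bar R) : (forall x, u x <= v x)%E ->
    (ereal_sup [set sintegral mu h | h in [set h : {nnsfun T >-> R} | forall x, (h x)%:E <= u x]] <=
     ereal_sup [set sintegral mu h | h in [set h : {nnsfun T >-> R} | forall x, (h x)%:E <= v x]])%E.
  move=> uv; apply: le_ereal_sup => _ [h /= hu <-]; exists h => //= x.
  exact: le_trans (hu x) (uv x).
move=> fg; rewrite /integral !patch_setT; apply: leeB; apply: mono => x.
  by apply: (@funepos_le _ _ setT) => [y _|]; rewrite ?inE.
by apply: (@funeneg_le _ _ setT) => [y _|]; rewrite ?inE.
Qed.

Lemma integral_affine (J : finType) (f : J -> T -> R) (c0 : R) (c : J -> R) :
  (forall j, mu.-integrable setT (EFin \o f j)) ->
  (\int[mu]_t (c0 + \sum_j c j * f j t)%:E = (c0 + \sum_j c j * \int[mu]_t f j t)%:E)%E.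
Proof.
move=> intf.
have intc : mu.-integrable setT (EFin \o cst c0) by exact: finite_measure_integrable_cst.
have intcf j : mu.-integrable setT (fun t => ((c j)%:E * (f j t)%:E)%E).
  exact: (integrableZl measurableT (c j) (intf j)).
have ints : mu.-integrable setT (fun t => \sum_j ((c j)%:E * (f j t)%:E)%E)%R.
  exact: (integrable_sum measurableT _ (fun j _ => intcf j)).
rewrite (eq_integral (fun t => ((EFin \o cst c0) \+ (fun t => \sum_j ((c j)%:E * (f j t)%:E)%E)%R) t)%E); last first.
  by move=> t _; rewrite /= EFinD -sumEFin.
have cstE : (\int[mu]_t (EFin \o cst c0) t = c0%:E)%E.
  apply: etrans (integral_cst mu measurableT c0%:E) _.
  by apply: etrans (congr1 (fun x => c0%:E * x)%E (probability_setT mu)) _; rewrite mule1.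
rewrite integralD // integral_sum // cstE EFinD -sumEFin; congr (_ + _)%E; apply: eq_bigr => j _.
rewrite (integralZl measurableT (intf j)) EFinM /Rintegral fineK //.
by apply: integrable_fin_num => //; exact: intf.
Qed.

End Integration.

(** * Borel measurability of continuous functions *)

Section Borel.
Variables (R : realType) (Om : ptopologicalType).

Lemma continuous_measurable_borel (f : Om -> R) :
  continuous f -> measurable_fun setT (f : borel Om -> R).
Proof.
move=> /continuousP cf; apply: (measurability _ (measurable_realfun.RGenOpens.measurableE R)).
move=> _ [_ [a [b ->]] <-]; rewrite setTI.
apply: sub_sigma_algebra; exact/cf/interval_open.
Qed.

End Borel.

(** * Continuity of eigenvalues and the trace norm *)

Section Spectra.
Local Open Scope complex_scope.
Local Open Scope ring_scope.
Local Open Scope classical_set_scope.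
Variables (R : realType) (N : nat) (I : 'I_N -> nat).
Local Notation C := R[i].
Local Notation normc := (@ComplexField.Normc.normc R).
Local Notation n := #|{: mindex I}|.

Lemma normc_le (z : C) : normc z <= `|complex.Re z| + `|complex.Im z|.
Proof.
case: z => a b /=; have a0 := normr_ge0 a; have b0 := normr_ge0 b.
rewrite -[leRHS]ger0_norm ?addr_ge0 // -sqrtr_sqr ler_wsqrtr //.
rewrite -(real_normK (num_real a)) -(real_normK (num_real b)); nra.
Qed.

Lemma kyfan_continuous (Om : topologicalType) (D : Om -> tensor R I) k :
  (0 < k)%N ->
  (forall ij, continuous (fun t : Om => (complex.Re (D t ij) : R)) /\
              continuous (fun t : Om => (complex.Im (D t ij) : R))) ->
  continuous (fun t => kyfan k (mx_of (D t))).
Proof.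
move=> k0 cD s; apply/cvgrPdist_lt => e e0.
pose K : R := n%:R * (n%:R * n%:R).
have K0 : 0 <= K by rewrite !mulr_ge0.
(* Half is for the real part and half for the imaginary part; [K + 1] avoids dividing by zero and
   makes the final inequality strict. *)
pose dl := e / (K + 1) / 2.
have dl0 : 0 < dl by rewrite !divr_gt0 // ltr_wpDl.
have nearD : \forall t \near s, forall ij : 'I_n * 'I_n,
    normc (mx_of (D s) ij.1 ij.2 - mx_of (D t) ij.1 ij.2) <= dl + dl.
  apply: filter_forall => -[i j] /=.
  have [cRe cIm] := cD (enum_val i, enum_val j).
  have /cvgrPdist_lt/(_ _ dl0) hRe := cRe s.
  have /cvgrPdist_lt/(_ _ dl0) hIm := cIm s.
  apply: filterS2 hRe hIm => t hRe hIm; rewrite !mxE.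
  apply: le_trans (normc_le _) _.
  by rewrite raddfB; apply: lerD; [exact: ltW hRe | rewrite raddfB; exact: ltW hIm].
apply: filterS nearD => t Dt; apply: le_lt_trans (kyfan_lipschitz _ _ k0) _.
apply: (@le_lt_trans _ _ (K * (dl + dl))).
  rewrite /K -mulrA ler_wpM2l //.
  apply: (@le_trans _ _ (\sum_(i < n) \sum_(j < n) (dl + dl))).
    by apply: ler_sum => i _; apply: ler_sum => j _; exact: (Dt (i, j)).
  by rewrite !sumr_const card_ord -mulrA !mulr_natl.
have -> : K * (dl + dl) = e * (K / (K + 1)) by rewrite /dl; field; rewrite gt_eqF // ltr_wpDl.
rewrite gtr_pMr // ltr_pdivrMr ?mul1r; last by rewrite ltr_wpDl.
by rewrite ltrDl.
Qed.

Lemma kyfan_heig k (H : tensor R I) : nonneg_herm H -> (0 < k <= hrank H)%N ->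
  kyfan k (mx_of H) = \sum_(i < k) (heig H)`_i.
Proof.
move=> nH /andP[k0 kr]; have [P uP ->] := heig_spec (leq_trans k0 kr).
have kn : (0 < k <= n)%N by rewrite k0 (leq_trans kr (unitary_rows_leq uP)).
rewrite (kyfan_spec uP kn (@heig_decr R N I H)) => [|i]; last exact/ltW/heig_gt0.
exact: psum_nth.
Qed.

(** An eigenvalue is the difference of two consecutive Ky Fan norms, which are continuous. *)
Lemma heig_continuous (Om : topologicalType) (D : Om -> tensor R I) r i :
  (forall t, nonneg_herm (D t)) -> (forall t, hrank (D t) = r) -> (i < r)%N ->
  (forall ij, continuous (fun t : Om => (complex.Re (D t ij) : R)) /\
              continuous (fun t : Om => (complex.Im (D t ij) : R))) ->
  continuous (fun t => (heig (D t))`_i).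
Proof.
move=> nD rD ir cD.
have cS k : (k <= r)%N -> continuous (fun t => \sum_(j < k) (heig (D t))`_j).
  case: k => [_|k kr].
    rewrite (_ : (fun t => _) = cst 0); first exact: cst_continuous.
    by apply/funext => t; rewrite big_ord0.
  rewrite (_ : (fun t => _) = fun t => kyfan k.+1 (mx_of (D t))).
    exact: kyfan_continuous.
  by apply/funext => t; rewrite kyfan_heig ?rD.
rewrite (_ : (fun t => _) =
  (fun t => \sum_(j < i.+1) (heig (D t))`_j) - (fun t => \sum_(j < i) (heig (D t))`_j)).
  by move=> s; apply: continuousB; apply: cS => //; exact: ltnW.
apply/funext => t; rewrite !fctE big_ord_recr /=; lra.
Qed.

(** The trace norm ignores the order of the eigenvalues, which matters for negative powers as they
    reverse it. *)
Lemma kyfan_full r (P : 'M[C]_(r, n)) (x : 'I_r -> R) :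
  P \is unitarymx -> (0 < n)%N -> (forall i, 0 <= x i) ->
  kyfan n (spec P x) = \sum_i x i.
Proof.
move=> uP n0 x0; have [s decs] := sorting_perm x.
have nn : (0 < n <= n)%N by rewrite n0 leqnn.
rewrite -(spec_perm (kyfan_uinv R n n0) x s uP uP) (kyfan_spec uP nn decs) => [|i]; last exact: x0.
rewrite [RHS](reindex_inj (@perm_inj _ s)) /=; apply: eq_bigl => i.
by rewrite (leq_trans (ltn_ord i)) ?(unitary_rows_leq uP).
Qed.

Lemma tfun_spec_rank (f : R -> R) (H : tensor R I) r : nonneg_herm H -> hrank H = r ->
  exists2 P : 'M[C]_(r, n),
    P \is unitarymx & mx_of (tfun f H) = spec P (fun i => f (expR (ln (heig H)`_i))).
Proof.
move=> nH rH; subst r; have [P uP ->] := tfun_spec f nH; exists P; first exact: uP.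
by congr spec; apply/funext => i; rewrite lnK // posrE heig_gt0.
Qed.

End Spectra.

(** * Affine lower bounds for norms in the logarithms of eigenvalues *)

Section SupportSpec.
Local Open Scope complex_scope.
Local Open Scope ring_scope.
Local Open Scope classical_set_scope.
Variables (R : realType) (n r : nat) (nrm : 'M[R[i]]_n -> R).
Hypothesis unrm : uinv nrm.

(** Each [psi i] is a dual weight times the slope of a tangent of [G] at [a i]. It is fixed before
    [Q], [s] and [b], so one bound serves for every point of the space. *)
Lemma spec_support (G : R -> R) (P : 'M[R[i]]_(r, n)) (a : 'I_r -> R) :
  (forall x, 0 <= G x) ->
  (forall x y t, 0 <= t <= 1 -> G (t * x + (1 - t) * y) <= t * G x + (1 - t) * G y) ->
  P \is unitarymx ->
  exists psi : 'I_r -> R, forall Q (s : 'S_r) b, Q \is unitarymx ->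
    nrm (spec P (fun i => G (a i))) + \sum_i psi i * (b (s i) - a i)
      <= nrm (spec Q (fun i => G (b i))).
Proof.
move=> G0 cvx uP.
have [w [w0 wE wle]] := spec_dual unrm uP (fun i => G0 (a i)).
have /choice [sl slP] : forall i : 'I_r, exists s, forall x, G (a i) + s * (x - a i) <= G x.
  by move=> i; exact: convex_support.
exists (fun i => w i * sl i) => Q s b uQ.
apply: le_trans (wle Q s _ uQ); rewrite -wE -big_split /=.
by apply: ler_sum => i _; rewrite -mulrA -mulrDr ler_wpM2l.
Qed.

(** The dual weights, normalized to [p i = w i * expR (h (a i)) / rho], sum to 1. Tangents of [h]
    bound the norm below by [rho] times a [p]-average of exponentials, and AM-GM finishes. *)
Lemma ln_spec_support (h : R -> R) (P : 'M[R[i]]_(r, n)) (a : 'I_r -> R) :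
  (forall x y t, 0 <= t <= 1 -> h (t * x + (1 - t) * y) <= t * h x + (1 - t) * h y) ->
  P \is unitarymx -> 0 < nrm (spec P (fun i => expR (h (a i)))) ->
  exists psi : 'I_r -> R, forall Q (s : 'S_r) b, Q \is unitarymx ->
    expR (ln (nrm (spec P (fun i => expR (h (a i))))) + \sum_i psi i * (b (s i) - a i))
      <= nrm (spec Q (fun i => expR (h (b i)))).
Proof.
move=> cvx uP rho0.
have [w [w0 wE wle]] := spec_dual unrm uP (fun i => expR_ge0 (h (a i))).
move: rho0 wE; set rho := nrm _ => rho0 wE.
have /choice [sl slP] : forall i : 'I_r, exists s, forall x, h (a i) + s * (x - a i) <= h x.
  by move=> i; exact: convex_support.
pose p i := w i * expR (h (a i)) / rho.
have p0 i : 0 <= p i by rewrite !mulr_ge0 ?expR_ge0 // invr_ge0 ltW.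
have sump : \sum_i p i = 1 by rewrite -mulr_suml wE divff // gt_eqF.
exists (fun i => p i * sl i) => Q s b uQ.
apply: le_trans (wle Q s _ uQ); rewrite expRD lnK ?posrE //.
pose z i := sl i * (b (s i) - a i); pose Z := \sum_i p i * z i.
have -> : \sum_i p i * sl i * (b (s i) - a i) = Z.
  by apply: eq_bigr => i _; rewrite mulrA.
(* Weighted AM-GM, from the tangent of [expR] at the weighted mean [Z]. *)
apply: (@le_trans _ _ (rho * \sum_i p i * expR (z i))).
  rewrite ler_pM2l //.
  apply: (@le_trans _ _ (expR Z * \sum_i p i * (1 + (z i - Z)))).
    have -> : \sum_i p i * (1 + (z i - Z)) = \sum_i p i + (Z - (\sum_i p i) * Z).
      by rewrite mulr_suml -sumrB -big_split; apply: eq_bigr => i _ /=; ring.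
    by rewrite sump mul1r subrr addr0 mulr1.
  rewrite mulr_sumr; apply: ler_sum => i _.
  rewrite mulrCA ler_wpM2l // -{2}(subrK Z (z i)) expRD mulrC ler_wpM2r ?expR_ge0 //.
  exact: expR_ge1Dx.
rewrite mulr_sumr; apply: ler_sum => i _.
have -> : rho * (p i * expR (z i)) = w i * expR (h (a i) + z i).
  by rewrite /p expRD; field; rewrite gt_eqF.
by rewrite ler_wpM2l // ler_expR; exact: slP.
Qed.

End SupportSpec.

(** * Log-majorization as majorization of logarithms *)

Section LogMaj.
Variable R : realType.

Lemma ln_le_tangent (k y : R) : 0 < k -> 0 < y -> ln y <= ln k + k^-1 * (y - k).
Proof.
move=> k0 y0; have yk : 0 < k^-1 * y by rewrite mulr_gt0 ?invr_gt0.
have -> : ln y = ln k + ln (k^-1 * y) by rewrite -lnM ?posrE // mulVKf ?gt_eqF.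
have -> : k^-1 * y = 1 + (k^-1 * (y - k)) by field; rewrite gt_eqF.
by rewrite lerD2l le_ln1Dx // mulrBr mulVf ?gt_eqF // ltrBrDl subrr.
Qed.

Lemma prode_expR k (F : nat -> \bar R) (u : nat -> R) :
  (forall i, (i < k)%N -> F i = (expR (u i))%:E) ->
  (\prod_(i < k) F i = (expR (\sum_(i < k) u i))%:E)%E.
Proof.
elim: k => [|k IH] h; first by rewrite !big_ord0 expR0.
rewrite !big_ord_recr /= IH => [|i ik]; last by rewrite h // ltnW.
by rewrite h // expRD EFinM.
Qed.

Lemma logmaj_expR (x y : seq (\bar R)) (u v : nat -> R) :
  (forall i, (i < size x)%N -> x`_i = (expR (u i))%:E) ->
  (forall i, (i < size x)%N -> y`_i = (expR (v i))%:E) ->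
  logmaj x y <->
  [/\ size x = size y,
      forall k, (k <= size x)%N -> \sum_(i < k) u i <= \sum_(i < k) v i
    & \sum_(i < size x) u i = \sum_(i < size x) v i].
Proof.
move=> xu yv.
have px k : (k <= size x)%N -> (\prod_(i < k) x`_i = (expR (\sum_(i < k) u i))%:E)%E.
  by move=> kx; apply: prode_expR => i ik; apply: xu; exact: leq_trans ik kx.
have py k : (k <= size x)%N -> (\prod_(i < k) y`_i = (expR (\sum_(i < k) v i))%:E)%E.
  by move=> kx; apply: prode_expR => i ik; apply: yv; exact: leq_trans ik kx.
rewrite /logmaj; split=> [[sxy [le eq]]|[sxy le eq]]; split=> //.
- by move=> k kx; have := le k kx; rewrite px // py // lee_fin ler_expR.
- by move: eq; rewrite px // py // => -[] /expR_inj.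
split; last by rewrite px // py // eq.
by move=> k kx; rewrite px // py // lee_fin ler_expR le.
Qed.

End LogMaj.

(** * Integrated inequalities for majorized vectors and for powers *)

Section Equivalence.
Context d (T : measurableType d) (R : realType) (mu : probability T R).
Variables (r : nat) (a : 'I_r -> R) (b : 'I_r -> T -> R).
Hypothesis intb : forall i, mu.-integrable setT (EFin \o b i).
Local Notation beta i := (\int[mu]_t b i t).

(** The permutation is chosen from [psi] and the integrals of the [b i] before integrating, hence is
    the same for all [t]; the lower bound is then affine in the [b i t] and integrates term by
    term. *)
Lemma le_integral_of_majorized (psi : 'I_r -> R) (c : R) (F : T -> \bar R) :
  decr a ->
  (forall k, (k <= r)%N ->
    \sum_(i < r | (i < k)%N) a i <= \sum_(i < r | (i < k)%N) beta i) ->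
  \sum_i a i = \sum_i beta i ->
  (forall t (s : 'S_r), ((c + \sum_i psi i * (b (s i) t - a i))%:E <= F t)%E) ->
  (c%:E <= \int[mu]_t F t)%E.
Proof.
move=> deca le eq Fge; have [s hs] := majorized_linear_le psi deca le eq.
apply: le_trans (le_integral_pointwise mu (fun t => Fge t s)).
rewrite (eq_integral (fun t => (c - \sum_i psi i * a i + \sum_i psi i * b (s i) t)%:E)).
  rewrite integral_affine => [|j]; last exact: intb.
  by rewrite lee_fin; lra.
move=> t _; congr EFin; rewrite -addrA; congr (_ + _).
by rewrite addrC -sumrB; apply: eq_bigr => i _; rewrite mulrBr.
Qed.

Let B i t := 4 * (expR (2 * b i t) + expR (- 2 * b i t)).
Hypothesis intB : forall i, mu.-integrable setT (EFin \o B i).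
Variable S : pred 'I_r.
Local Notation K := (\sum_(i | S i) \int[mu]_t B i t).

Lemma integral_taylor (p c0 c : R) :
  (\int[mu]_t (c0 + c * (p * \sum_(i | S i) b i t + p ^+ 2 * \sum_(i | S i) B i t))%:E =
   (c0 + c * (p * \sum_(i | S i) beta i + p ^+ 2 * K))%:E)%E.
Proof.
(* The disjoint sum of indices makes the [b i] and [B i] a single family for [integral_affine]. *)
pose f (j : 'I_r + 'I_r) := match j with inl i => b i | inr i => B i end.
pose e (j : 'I_r + 'I_r) : R := match j with
  inl i => if S i then c * p else 0 | inr i => if S i then c * p ^+ 2 else 0 end.
have intf j : mu.-integrable setT (EFin \o f j) by case: j.
have sumE (z : 'I_r + 'I_r -> R) :
    \sum_j e j * z j =
    c * (p * \sum_(i | S i) z (inl i) + p ^+ 2 * \sum_(i | S i) z (inr i)).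
  rewrite big_sumType /= mulrDr !mulrA !mulr_sumr; congr (_ + _);
    by rewrite [RHS]big_mkcond; apply: eq_bigr => i _; case: ifP; rewrite ?mul0r.
have := integral_affine c0 e intf; rewrite sumE => <-.
by apply: eq_integral => t _; rewrite (sumE (fun j => f j t)).
Qed.

Lemma sum_expR_taylor (p : R) t : `|p| <= 1 ->
  \sum_(i | S i) expR (p * b i t) <=
  \sum_(i | S i) 1 + (p * \sum_(i | S i) b i t + p ^+ 2 * \sum_(i | S i) B i t).
Proof.
move=> p1; rewrite !mulr_sumr -!big_split /=; apply: ler_sum => i _.
by rewrite addrA; exact: expR_taylor.
Qed.

(** Jensen's inequality with equal weights on [S], from the tangent of [expR] at the mean [m]. *)
Lemma sum_expR_ge (x : 'I_r -> R) : (0 < \sum_(i | S i) (1 : R)) ->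
  (\sum_(i | S i) 1) * expR ((\sum_(i | S i) x i) / \sum_(i | S i) 1)
    <= \sum_(i | S i) expR (x i).
Proof.
set k := \sum_(i | S i) 1 => k0; set m := _ / k.
apply: (@le_trans _ _ (\sum_(i | S i) expR m * (1 + (x i - m)))).
  rewrite -mulr_sumr mulrC big_split /= sumrB -/k.
  have -> : \sum_(i | S i) m = k * m by rewrite /k mulr_suml; apply: eq_bigr => i _; rewrite mul1r.
  by rewrite /m mulrCA divff ?gt_eqF // mulr1 subrr addr0.
apply: ler_sum => i _; rewrite -{2}(subrK m (x i)) expRD mulrC ler_wpM2r ?expR_ge0 //.
exact: expR_ge1Dx.
Qed.

(** Bound the left side below by [1 + x <= expR x] and the integrand above by [expR_taylor]; the
    constant terms cancel. *)
Lemma power_integral_le (p : R) : `|p| <= 1 ->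
  ((\sum_(i | S i) expR (p * a i))%:E <=
     \int[mu]_t (\sum_(i | S i) expR (p * b i t))%:E)%E ->
  p * \sum_(i | S i) a i <= p * \sum_(i | S i) beta i + p ^+ 2 * K.
Proof.
move=> p1 h; have := le_trans h (le_integral_pointwise mu _).
move=> /(_ (fun t => (\sum_(i | S i) 1 + 1 * (p * \sum_(i | S i) b i t + p ^+ 2 * \sum_(i | S i) B i t))%:E)).
rewrite integral_taylor mul1r lee_fin.
have ha : \sum_(i | S i) 1 + p * \sum_(i | S i) a i <= \sum_(i | S i) expR (p * a i).
  by rewrite mulr_sumr -big_split; apply: ler_sum => i _; exact: expR_ge1Dx.
move=> /(_ _)/(le_trans ha); rewrite lerD2l; apply=> t.
by rewrite lee_fin mul1r; exact: sum_expR_taylor.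
Qed.

(** Here the logarithm of the integrand is bounded by its tangent at the cardinality [k] of [S], and
    Jensen's inequality bounds the left side; the factor [k] cancels. *)
Lemma power_lnE_integral_le (p : R) : `|p| <= 1 -> (0 < \sum_(i | S i) (1 : R)) ->
  ((\sum_(i | S i) expR (p * a i))%:E <=
     expeR (\int[mu]_t lnE (\sum_(i | S i) expR (p * b i t))))%E ->
  p * \sum_(i | S i) a i <= p * \sum_(i | S i) beta i + p ^+ 2 * K.
Proof.
move=> p1 k0 h; set k := \sum_(i | S i) (1 : R) in k0.
have lnk t : (lnE (\sum_(i | S i) expR (p * b i t)) <=
   (ln k + k^-1 * (p * \sum_(i | S i) b i t + p ^+ 2 * \sum_(i | S i) B i t))%:E)%E.
  rewrite /lnE; case: lerP => [_|y0]; first by rewrite leNye.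
  have := sum_expR_taylor t p1; rewrite -/k; move: y0; set y := \sum_(i | S i) _ => y0 yle.
  rewrite lee_fin; apply: le_trans (ln_le_tangent k0 y0) _.
  by rewrite lerD2l ler_pM2l ?invr_gt0 // lerBlDl.
have : (expeR (\int[mu]_t lnE (\sum_(i | S i) expR (p * b i t))) <=
    (expR (ln k + k^-1 * (p * \sum_(i | S i) beta i + p ^+ 2 * K)))%:E)%E.
  apply: (@le_trans _ _ (expeR (ln k + k^-1 * (p * \sum_(i | S i) beta i + p ^+ 2 * K))%:E)) => //.
  by rewrite lee_expeR -integral_taylor; exact: le_integral_pointwise.
move=> /(le_trans h); rewrite lee_fin expRD lnK ?posrE //.
have := sum_expR_ge (fun i => p * a i) k0; rewrite -/k => /le_trans /[apply].
by rewrite ler_pM2l // ler_expR -mulr_sumr mulrC ler_pM2l ?invr_gt0.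
Qed.

End Equivalence.

(** * Power functions as test functions, and zeros of log-convex functions *)

Section TestFunctions.
Variable R : realType.

(** The power [x ^ p] for positive [x]. *)
Definition expln (p x : R) := expR (p * ln x).

Lemma explnE (p z : R) : expln p (expR z) = expR (p * z).
Proof. by rewrite /expln expRK. Qed.

Lemma expln_continuous p : {within `]0, +oo[, continuous (expln p)}.
Proof.
apply: continuous_in_subspaceT => x; rewrite inE /= in_itv /= andbT => x0.
apply: continuous_comp; last exact: continuous_expR.
by apply: continuousM; [exact: cst_continuous | exact: continuous_ln].
Qed.

Lemma lnE_gt0 (x : R) : 0 < x -> lnE x = (ln x)%:E.
Proof. by rewrite /lnE; case: lerP. Qed.

Lemma expln_logexp_convex p : logexp_convex (expln p).
Proof.
move=> x y t t01; rewrite !explnE !lnE_gt0 ?expR_gt0 // !expRK.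
by rewrite -!EFinM -EFinD lee_fin le_eqVlt; apply/orP; left; apply/eqP; ring.
Qed.

Lemma expln_exp_convex p : exp_convex (expln p).
Proof.
move=> x y t /andP[t0 t1]; rewrite !explnE.
set m := p * (t * x + _); have e0 := expR_gt0 m.
have tangent z : expR m * (1 + (p * z - m)) <= expR (p * z).
  have -> : expR (p * z) = expR m * expR (p * z - m) by rewrite -expRD; congr expR; ring.
  by rewrite ler_wpM2l ?expR_ge1Dx // ltW.
have t1' : 0 <= 1 - t by rewrite subr_ge0.
apply: le_trans (lerD (ler_wpM2l t0 (tangent x)) (ler_wpM2l t1' (tangent y))).
by rewrite /m le_eqVlt; apply/orP; left; apply/eqP; ring.
Qed.

(** A logarithm equal to [-oo] at one end of a segment forces [-oo] at its midpoint. Hence [f]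
    vanishes at all positive points or at none. *)
Lemma logexp_convex_eq0 (f : R -> R) z0 z :
  (forall x, 0 < x -> 0 <= f x) -> logexp_convex f ->
  f (expR z0) = 0 -> f (expR z) = 0.
Proof.
move=> f0 cvx fz0; apply/eqP; rewrite eq_le f0 ?expR_gt0 // andbT.
(* [z] is the midpoint of [z0] and [2 * z - z0]. *)
have := cvx z0 (2 * z - z0) (2^-1).
have -> : 2^-1 * z0 + (1 - 2^-1) * (2 * z - z0) = z by field.
have -> : lnE (f (expR z0)) = -oo%E by rewrite /lnE fz0 lexx.
rewrite gt0_muleNy ?lte_fin ?invr_gt0 // addNye leeNy_eq => /(_ ltac:(lra)).
by rewrite /lnE; case: ifP.
Qed.

Lemma logexp_convex_ln (f : R -> R) :
  (forall z, 0 < f (expR z)) -> logexp_convex f ->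
  forall x y t, 0 <= t <= 1 ->
    ln (f (expR (t * x + (1 - t) * y))) <= t * ln (f (expR x)) + (1 - t) * ln (f (expR y)).
Proof.
move=> f0 cvx x y t t01; have := cvx x y t t01.
by rewrite !lnE_gt0 // -!EFinM -EFinD lee_fin.
Qed.

Lemma le_of_perturbation (x y K : R) :
  (forall p, 0 < p <= 1 -> p * x <= p * y + p ^+ 2 * K) -> x <= y.
Proof.
move=> h; rewrite leNgt; apply/negP => yx.
(* So small that [p * K] stays below half of [x - y], which contradicts the hypothesis divided by
   [p]. *)
pose p := Num.min 1 ((x - y) / (2 * (`|K| + 1))).
have K0 : 0 < 2 * (`|K| + 1) by rewrite mulr_gt0 // ltr_wpDl.
have p0 : 0 < p by rewrite lt_min ltr01 divr_gt0 // subr_gt0.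
have p1 : p <= 1 by rewrite ge_min lexx.
have pK : p * (2 * (`|K| + 1)) <= x - y by rewrite -ler_pdivlMr // ge_min lexx orbT.
have := h p; rewrite p0 p1 => /(_ isT); rewrite expr2 -mulrA -mulrDr ler_pM2l //.
have := ler_norm K; have := normr_ge0 K; nra.
Qed.

End TestFunctions.

(** * The three statements for a tensor and a continuous family *)

Section Main.
Variables (R : realType) (N : nat) (I : 'I_N -> nat).
Variables (Om : pseudoPMetricType R) (nu : probability (borel Om) R).
Variables (C : tensor R I) (D : Om -> tensor R I) (r : nat).
Hypothesis nC : nonneg_herm C.
Hypothesis nD : forall t, nonneg_herm (D t).
Hypothesis cD : forall ij, continuous (fun t : Om => (complex.Re (D t ij) : R)) /\
                           continuous (fun t : Om => (complex.Im (D t ij) : R)).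
Hypothesis bD : exists M : R, forall t, opnorm_le (D t) M.
Hypothesis rC : hrank C = r.
Hypothesis rD : forall t, hrank (D t) = r.
Hypothesis intD : forall (p : R) (nrm : tensor R I -> R), 0 < p -> ui_norm nrm ->
  (\int[nu]_t (nrm (tfun (fun x => x `^ (- p)) (D t)))%:E < +oo)%E.
Local Notation n := #|{: mindex I}|.

Let a (i : 'I_r) : R := ln (heig C)`_i.
Let b (i : 'I_r) (t : borel Om) : R := ln (heig (D t))`_i.

Let expR_b i t : expR (b i t) = (heig (D t))`_i.
Proof. by rewrite /b lnK // posrE heig_gt0 // rD. Qed.

Let expR_a i : expR (a i) = (heig C)`_i.
Proof. by rewrite /a lnK // posrE heig_gt0 // rC. Qed.

Lemma heig_decr_rank (H : tensor R I) : hrank H = r -> decr (fun i : 'I_r => (heig H)`_i).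
Proof. by move=> <-; exact: heig_decr. Qed.

Let a_decr : decr a.
Proof. by move=> i j ij; rewrite -ler_expR !expR_a; exact: (heig_decr_rank rC). Qed.

Let rank_le : (r <= n)%N.
Proof.
have [->//|r0] := posnP r; have := r0; rewrite -rC => r0'.
by have [P uP _] := heig_spec r0'; exact: unitary_rows_leq uP.
Qed.

Let b_meas i : measurable_fun setT (b i).
Proof.
apply: measurableT_comp => //; apply: continuous_measurable_borel.
exact: (heig_continuous nD rD (ltn_ord i) cD).
Qed.

Let expRb_meas (p : R) i : measurable_fun setT (fun t => expR (p * b i t)).
Proof.
apply: measurableT_comp => //; apply: measurable_funM => //.
Qed.

(** For the power 2 the bound on operator norms suffices. For the power -2 an eigenvalue of the
    inverse square is at most its trace norm, integrable by assumption. *)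
Let expRb_int (p : R) i : p = 2 \/ p = -2 ->
  nu.-integrable setT (fun t => (expR (p * b i t))%:E).
Proof.
move=> p2; apply/integrableP; split; first exact/measurable_EFinP.
have [M bM] := bD.
case: p2 => ->.
  apply: (@le_lt_trans _ _ (\int[nu]_t (M ^+ 2)%:E)%E).
    apply: le_integral_pointwise => t.
    have l0 : 0 < (heig (D t))`_i by rewrite heig_gt0 // rD.
    have lM : (heig (D t))`_i <= M by apply: heig_le_opnorm; rewrite // rD.
    rewrite gee0_abs ?lee_fin ?expR_ge0 //.
    have -> : expR (2 * b i t) = (heig (D t))`_i ^+ 2.
      by rewrite -expR_b expr2 -expRD; congr expR; ring.
    by rewrite ler_pXn2r // nnegrE ltW // (lt_le_trans l0).
  by apply: integrable_lty => //; exact: (finite_measure_integrable_cst nu (M ^+ 2) measurableT).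
have n0 : (0 < n)%N by rewrite (leq_trans _ rank_le) // (leq_trans _ (ltn_ord i)).
apply: le_lt_trans (intD (ltr0n R 2) (uinv_ui_norm (kyfan_uinv R n n0))).
apply: le_integral_pointwise => t; rewrite gee0_abs ?lee_fin ?expR_ge0 //.
have [P uP ->] := tfun_spec_rank (fun x => x `^ (- 2)) (nD t) (rD t).
rewrite (kyfan_full uP n0) => [|j]; last exact: powR_ge0.
rewrite (bigD1 i) //= /powR gt_eqF ?expR_gt0 // expRK lerDl.
by apply: sumr_ge0 => j _; exact: powR_ge0.
Qed.

Let B i t := 4 * (expR (2 * b i t) + expR (- 2 * b i t)).

Let B_int i : nu.-integrable setT (EFin \o B i).
Proof.
have i1 := expRb_int i (or_introl erefl); have i2 := expRb_int i (or_intror erefl).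
have := integrableZl measurableT 4 (integrableD measurableT i1 i2).
by apply: eq_integrable => // t _; rewrite /= EFinM EFinD.
Qed.

Let b_int i : nu.-integrable setT (EFin \o b i).
Proof.
apply: (le_integrable measurableT _ _ (B_int i)); first exact/measurable_EFinP.
move=> t _ /=; rewrite lee_fin [leRHS]ger0_norm ?mulr_ge0 ?addr_ge0 ?expR_ge0 //.
have h := expR_norm_le (b i t); have h2 := expR_ge1Dx (2 * `|b i t|).
have := normr_ge0 (b i t); rewrite /B; lra.
Qed.

Definition log_majorized :=
  (forall k, (k <= r)%N ->
    \sum_(i < r | (i < k)%N) a i <= \sum_(i < r | (i < k)%N) \int[nu]_t b i t) /\
  \sum_i a i = \sum_i \int[nu]_t b i t.

(** All eigenvalues up to the rank are positive and their logarithms integrable, so every entry is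
    the exponential of a real number. *)
Lemma logmaj_log_majorized :
  logmaj [seq x%:E | x <- heig C]
     [seq expeR (\int[nu]_t lnE (heig (D t))`_i)%E | i <- iota 0 r] <-> log_majorized.
Proof.
pose u (i : nat) := ln (heig C)`_i; pose v (i : nat) := \int[nu]_t ln (heig (D t))`_i.
have szC : size [seq x%:E | x <- heig C] = r by rewrite size_map.
have xu i : (i < size [seq x%:E | x <- heig C])%N -> [seq x%:E | x <- heig C]`_i = (expR (u i))%:E.
  rewrite size_map => ir; rewrite (nth_map 0) //; congr EFin.
  by rewrite /u lnK // posrE; exact: heig_gt0.
rewrite (@logmaj_expR _ _ _ u v) // szC => [|i ir]; last first.
  rewrite (nth_map 0%N) ?size_iota // nth_iota // add0n /v.
  have bi := b_int (Ordinal ir).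
  rewrite (eq_integral (fun t => (b (Ordinal ir) t)%:E)); last first.
    by move=> t _; rewrite lnE_gt0 // heig_gt0 // rD.
  have -> : (\int[nu]_t (b (Ordinal ir) t)%:E = (\int[nu]_t b (Ordinal ir) t)%:E)%E; last by [].
  by rewrite /Rintegral fineK //; exact: (integrable_fin_num measurableT bi).
have uE k : (k <= r)%N -> \sum_(i < k) u i = \sum_(i < r | (i < k)%N) a i.
  by move=> kr; rewrite (big_ord_widen r u kr).
have vE k : (k <= r)%N -> \sum_(i < k) v i = \sum_(i < r | (i < k)%N) \int[nu]_t b i t.
  by move=> kr; rewrite (big_ord_widen r v kr).
rewrite /log_majorized; split=> [[_ le eq]|[le eq]]; split=> //.
- by move=> k kr; rewrite -uE // -vE // le.
- by rewrite size_map size_iota.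
- by move=> k kr; rewrite uE // vE // le.
Qed.

Lemma log_majorized_exp_convex (g : R -> R) (nrm : tensor R I -> R) :
  log_majorized -> (forall x, 0 < x -> 0 <= g x) -> exp_convex g -> ui_norm nrm ->
  ((nrm (tfun g C))%:E <= \int[nu]_t (nrm (tfun g (D t)))%:E)%E.
Proof.
move=> [le eq] g0 cvx unrm; have unrm' := ui_norm_uinv unrm.
have [P uP PE] := tfun_spec_rank g nC rC.
have [psi psiP] := spec_support unrm' (G := fun z => g (expR z)) a (fun z => g0 _ (expR_gt0 z)) cvx uP.
rewrite -[tfun g C]mx_ofK PE.
apply: (le_integral_of_majorized b_int a_decr le eq (psi := psi)) => t s.
have [Q uQ QE] := tfun_spec_rank g (nD t) (rD t).
by rewrite -[tfun g (D t)]mx_ofK QE lee_fin; exact: (psiP Q s (b^~ t) uQ).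
Qed.

Lemma log_majorized_logexp_convex (f : R -> R) (nrm : tensor R I -> R) :
  log_majorized -> (forall x, 0 < x -> 0 <= f x) -> logexp_convex f -> ui_norm nrm ->
  ((nrm (tfun f C))%:E <= expeR (\int[nu]_t lnE (nrm (tfun f (D t)))))%E.
Proof.
move=> [le eq] f0 cvx unrm; have unrm' := ui_norm_uinv unrm.
have [P uP PE] := tfun_spec_rank f nC rC; have [nrm0 _ nrmZ _ _] := unrm'.
have [C0|C0] := eqVneq (nrm (tfun f C)) 0; first by rewrite C0 expeR_ge0.
have {}C0 : 0 < nrm (tfun f C).
  by rewrite lt_neqAle eq_sym C0 -[tfun f C]mx_ofK nrm0.
(* If [f] vanished at one positive point it would vanish at all, making [tfun f C] zero against
   [C0]. *)
have fpos z : 0 < f (expR z).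
  rewrite lt_neqAle f0 ?expR_gt0 // andbT eq_sym; apply: contraTneq C0 => fz.
  rewrite -[tfun f C]mx_ofK PE.
  have -> : spec P (fun i : 'I_r => f (expR (ln (heig C)`_i))) = 0 *: 0.
    apply/matrixP => i j; rewrite specE scale0r mxE big1 // => l _.
    by rewrite (logexp_convex_eq0 _ f0 cvx fz) mul0r.
  by rewrite nrmZ ComplexField.Normc.normc0 mul0r ltxx.
pose h z := ln (f (expR z)).
have hE r' (x : 'I_r' -> R) : (fun i => f (expR (x i))) = (fun i => expR (h (x i))).
  by apply/funext => i; rewrite /h lnK // posrE.
rewrite -[tfun f C]mx_ofK PE (hE _ a) in C0 *.
have [psi psiP] := ln_spec_support unrm' (h := h) (a := a) (logexp_convex_ln fpos cvx) uP C0.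
rewrite -{1}(lnK C0) -[X in (X <= _)%E]/(expeR (ln _)%:E) lee_expeR.
apply: (le_integral_of_majorized b_int a_decr le eq (psi := psi)) => t s.
have [Q uQ QE] := tfun_spec_rank f (nD t) (rD t).
rewrite -[tfun f (D t)]mx_ofK QE (hE _ (b^~ t)).
have := psiP Q s (b^~ t) uQ; set X := _ + _ => hX.
(* The lower bound also shows that the norm at [t] is positive, so its [lnE] is a real logarithm. *)
have N0 := lt_le_trans (expR_gt0 _) hX.
by rewrite lnE_gt0 // lee_fin -[X]expRK ler_ln ?posrE ?expR_gt0.
Qed.

(** A positive power keeps the eigenvalues in decreasing order, so the [k]-th Ky Fan norm sums the
    first [k] of them; for other powers the full sum comes from the trace norm. *)
Lemma exists_ui_norm_power_sum k (p : R) : (0 < k <= r)%N -> 0 < p \/ k = r ->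
  exists2 nrm : tensor R I -> R, ui_norm nrm &
    forall H, nonneg_herm H -> hrank H = r ->
      nrm (tfun (expln p) H) = \sum_(i < r | (i < k)%N) expR (p * ln (heig H)`_i).
Proof.
move=> /andP[k0 kr] [p0|kE].
  exists (fun A => kyfan k (mx_of A)); first exact/uinv_ui_norm/kyfan_uinv.
  move=> H nH rH; have [P uP ->] := tfun_spec_rank (expln p) nH rH.
  rewrite (kyfan_spec uP).
  - by apply: eq_bigr => i _; rewrite explnE.
  - by rewrite k0 (leq_trans kr rank_le).
  - move=> i j ij; rewrite !explnE ler_expR ler_pM2l // ler_ln ?posrE ?heig_gt0 ?rH //.
    exact: (heig_decr_rank rH).
  - by move=> i; exact: expR_ge0.
have n0 : (0 < n)%N by rewrite (leq_trans k0) // (leq_trans kr rank_le).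
exists (fun A => kyfan n (mx_of A)); first exact/uinv_ui_norm/kyfan_uinv.
move=> H nH rH; have [P uP ->] := tfun_spec_rank (expln p) nH rH.
rewrite (kyfan_full uP n0) => [|i]; last exact: expR_ge0.
by apply: eq_big => i; [rewrite kE ltn_ord | rewrite explnE].
Qed.

(* Letting the exponent [p] tend to [0+] gives the inequalities between partial
   sums of logarithms; [p -> 0-] for the full sum gives the reverse inequality. *)
Lemma log_majorized_of_powers :
  (forall k (p : R), (0 < k <= r)%N -> 0 < p \/ k = r -> `|p| <= 1 ->
    p * \sum_(i < r | (i < k)%N) a i <=
    p * \sum_(i < r | (i < k)%N) \int[nu]_t b i t +
    p ^+ 2 * \sum_(i < r | (i < k)%N) \int[nu]_t B i t) ->
  log_majorized.
Proof.
move=> pow.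
have le k : (k <= r)%N ->
    \sum_(i < r | (i < k)%N) a i <= \sum_(i < r | (i < k)%N) \int[nu]_t b i t.
  case: k => [_|k kr]; first by rewrite !big_pred0.
  apply: (@le_of_perturbation _ _ _ (\sum_(i < r | (i < k.+1)%N) \int[nu]_t B i t)).
  move=> p /andP[p0 p1]; apply: pow => //; first by left.
  by rewrite ger0_norm // ltW.
split=> //; apply/eqP; rewrite eq_le.
have full (F : 'I_r -> R) : \sum_i F i = \sum_(i < r | (i < r)%N) F i.
  by apply: eq_bigl => i; rewrite ltn_ord.
rewrite !full le //=; have [r0|r0] := posnP r.
  by rewrite !big1 // => i; have := ltn_ord i; rewrite {2}r0.
apply: (@le_of_perturbation _ _ _ (\sum_(i < r | (i < r)%N) \int[nu]_t B i t)).
move=> p /andP[p0 p1]; have := pow r (- p); rewrite r0 leqnn normrN (ger0_norm (ltW p0)).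
by move=> /(_ isT (or_intror erefl) p1); rewrite sqrrN !mulNr; lra.
Qed.

Lemma exp_convex_log_majorized :
  (forall (g : R -> R) (nrm : tensor R I -> R),
      {within `]0, +oo[, continuous g} ->
      (forall x, 0 < x -> 0 <= g x) -> exp_convex g -> ui_norm nrm ->
      ((nrm (tfun g C))%:E <= \int[nu]_t (nrm (tfun g (D t)))%:E)%E) ->
  log_majorized.
Proof.
move=> h; apply: log_majorized_of_powers => k p kr pk p1.
have [nrm unrm nrmE] := exists_ui_norm_power_sum kr pk.
have := h _ nrm (@expln_continuous _ p) (fun x _ => expR_ge0 _) (@expln_exp_convex _ p) unrm.
rewrite nrmE //; under eq_integral do rewrite nrmE //.
exact: (power_integral_le b_int B_int p1).
Qed.

Lemma logexp_convex_log_majorized :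
  (forall (f : R -> R) (nrm : tensor R I -> R),
      {within `]0, +oo[, continuous f} ->
      (forall x, 0 < x -> 0 <= f x) -> logexp_convex f -> ui_norm nrm ->
      ((nrm (tfun f C))%:E <= expeR (\int[nu]_t lnE (nrm (tfun f (D t)))))%E) ->
  log_majorized.
Proof.
move=> h; apply: log_majorized_of_powers => k p kr pk p1.
have [nrm unrm nrmE] := exists_ui_norm_power_sum kr pk.
have := h _ nrm (@expln_continuous _ p) (fun x _ => expR_ge0 _) (@expln_logexp_convex _ p) unrm.
rewrite nrmE //; under eq_integral do rewrite nrmE //.
apply: (power_lnE_integral_le b_int B_int p1).
case/andP: kr => k0 kr; rewrite (bigD1 (Ordinal (leq_trans k0 kr))) //=.
by rewrite ltr_wpDr // sumr_ge0.
Qed.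

End Main.

Theorem theorem3p4 (R : realType) (N : nat) (I : 'I_N -> nat)
  (Om : pseudoPMetricType R) (nu : probability (borel Om) R)
  (C : tensor R I) (D : Om -> tensor R I) (r : nat) :
  hausdorff_space Om -> sigma_compact Om ->
  nonneg_herm C -> (forall t, nonneg_herm (D t)) ->
  (forall ij, continuous (fun t : Om => (complex.Re (D t ij) : R)) /\
              continuous (fun t : Om => (complex.Im (D t ij) : R))) ->
  (exists M : R, forall t, opnorm_le (D t) M) ->
  hrank C = r -> (forall t, hrank (D t) = r) ->
  (forall (p : R) (nrm : tensor R I -> R), 0 < p -> ui_norm nrm ->
     (\int[nu]_t (nrm (tfun (fun x => x `^ (- p)) (D t)))%:E < +oo)%E) ->
  [<->
   (* (i) *)
   logmaj [seq x%:E | x <- heig C]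
     [seq expeR (\int[nu]_t lnE (heig (D t))`_i)%E | i <- iota 0 r];
   (* (ii) *)
   (forall (f : R -> R) (nrm : tensor R I -> R),
      {within `]0, +oo[, continuous f} ->
      (forall x, 0 < x -> 0 <= f x) -> logexp_convex f -> ui_norm nrm ->
      ((nrm (tfun f C))%:E <= expeR (\int[nu]_t lnE (nrm (tfun f (D t)))))%E);
   (* (iii) *)
   (forall (g : R -> R) (nrm : tensor R I -> R),
      {within `]0, +oo[, continuous g} ->
      (forall x, 0 < x -> 0 <= g x) -> exp_convex g -> ui_norm nrm ->
      ((nrm (tfun g C))%:E <= \int[nu]_t (nrm (tfun g (D t)))%:E)%E)].
Proof.
move=> _ _ nC nD cD bD rC rD intD.
have majP := logmaj_log_majorized nC nD cD bD rC rD intD.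
have to_exp := log_majorized_exp_convex nC nD cD bD rC rD intD.
have to_logexp := log_majorized_logexp_convex nC nD cD bD rC rD intD.
have of_exp := exp_convex_log_majorized nC nD cD bD rC rD intD.
have of_logexp := logexp_convex_log_majorized nC nD cD bD rC rD intD.
(* The cycle is (i) to (ii) to (iii) to (i); its middle arrow passes through the
   log-majorization. *)
tfae.
- by move=> /majP maj f nrm _; exact: to_logexp.
- by move=> /of_logexp maj g nrm _; exact: to_exp.
- by move=> /of_exp /majP.
Qed.
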